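(* Let $(R,\mathfrak n)$ be a regular local ring, let $P=\mathrm{gr}_{\mathfrak n}(R)$, and let $M\neq 0$ be a finitely generated $R$-module equipped with a stable $\mathfrak n$-filtration $\mathbb M=\{M_j\}_{j\ge 0}$ such that $\mu(M)=\mu(\mathrm{gr}_{\mathbb M}(M))$. If $\mathrm{gr}_{\mathbb M}(M)$ is a componentwise linear $P$-module, then $M$ is Koszul.
   Context: Let $(R,\mathfrak n)$ be a regular local ring with residue field $k$. Then $P=\mathrm{gr}_{\mathfrak n}(R)=\bigoplus_{i\ge 0}\mathfrak n^i/\mathfrak n^{i+1}$ is a standard graded polynomial ring over $k$ in $\dim R$ variables. A stable $\mathfrak n$-filtration on a finitely generated $R$-module $M$ is a descending chain of submodules $M=M_0\supseteq M_1\supseteq M_2\supseteq\cdots$ with $\mathfrak n M_j\subseteq M_{j+1}$ for all $j\ge 0$ and $\mathfrak n M_j=M_{j+1}$ for all sufficiently large $j$. The associated graded module is $\mathrm{gr}_{\mathbb M}(M)=\bigoplus_{j\ge 0}M_j/M_{j+1}$, a finitely generated graded $P$-module. $\mu(\cdot)$ denotes the minimal number of generators (of an $R$-module, or of a graded $P$-module). For a finitely generated graded $P$-module $N$ put $\beta_{i,j}(N)=\dim_k \mathrm{Tor}^P_i(k,N)_j$. $N$ has a $d$-linear resolution if $\beta_{i,j}(N)=0$ for all $i$ and all $j\ne d+i$. For $d\in\mathbb Z$, $N_{\langle d\rangle}$ is the submodule of $N$ generated by all homogeneous elements of $N$ of degree $d$. $N$ is componentwise linear if $N_{\langle d\rangle}$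 has a $d$-linear resolution for every $d\in\mathbb Z$. A finitely generated $R$-module $M$ is Koszul if the associated graded module with respect to the $\mathfrak n$-adic filtration, $\mathrm{gr}_{\mathfrak n}(M)=\bigoplus_{i\ge 0}\mathfrak n^iM/\mathfrak n^{i+1}M$ (which is generated in degree $0$), has a ($0$-)linear resolution as a graded $P$-module. *)

(* Defs.v *)
From HB Require Import structures.
From mathcomp Require Import all_boot all_order all_algebra.
From mathcomp Require Import boolp classical_sets functions.

Set Implicit Arguments.
Unset Strict Implicit.
Unset Printing Implicit Defensive.
Import Order.TTheory GRing.Theory.
Local Open Scope ring_scope.
Local Open Scope classical_set_scope.
Local Open Scope quotient_scope.

Section Submodules.
Variables (S : pzRingType) (M : lmodType S).

Definition submodule (A : set M) : Prop :=
  [/\ A 0, forall x y, A x -> A y -> A (x + y) & forall a x, A x -> A (a *: x)].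

(* Finite sums of products a *: x with a in I and x in A: the submodule I A
   when I is an ideal, and the submodule generated by A when I = setT. *)
Definition smul (I : set S) (A : set M) : set M :=
  [set y | exists s : seq (S * M),
     (forall p, p \in s -> I p.1 /\ A p.2) /\ y = \sum_(p <- s) p.1 *: p.2].

Definition generated_by (A : set M) (m : nat) : Prop :=
  exists x : 'I_m -> M,
    A = [set y | exists c : 'I_m -> S, y = \sum_(l < m) c l *: x l].

(* mu (A) = m *)
Definition is_mu (A : set M) (m : nat) : Prop :=
  generated_by A m /\ forall m', generated_by A m' -> (m <= m')%N.

Definition fin_gen (A : set M) : Prop := exists m, generated_by A m.

End Submodules.

Section LocalRings.
Variable R : comNzRingType.

Definition ideal (I : set R) : Prop := submodule (I : set R^o).

Definition maximal_ideal (I : set R) : Prop :=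
  [/\ ideal I, I <> setT &
      forall J, ideal J -> I `<=` J -> J = I \/ J = setT].

Definition prime_ideal (I : set R) : Prop :=
  [/\ ideal I, I <> setT & forall a b, I (a * b) -> I a \/ I b].

Definition local_ring (n : set R) : Prop :=
  maximal_ideal n /\ forall I, maximal_ideal I -> I = n.

Definition noetherian : Prop :=
  forall I : set R, ideal I -> fin_gen (I : set R^o).

Definition prime_chain (d : nat) : Prop :=
  exists p : nat -> set R,
    (forall i, (i <= d)%N -> prime_ideal (p i)) /\
    (forall i, (i < d)%N -> p i `<` p i.+1).

Definition krull_dim (d : nat) : Prop :=
  prime_chain d /\ forall e, prime_chain e -> (e <= d)%N.

Definition regular_local (n : set R) : Prop :=
  [/\ local_ring n, noetherian &
      exists d, krull_dim d /\ is_mu (n : set R^o) d].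

End LocalRings.

Section Filtrations.
Variables (R : comNzRingType) (n : set R) (M : lmodType R).

Record filtration := Filtration {
  fil :> nat -> set M;
  fil0 : fil 0%N = setT;
  fil_submodule : forall j, submodule (fil j);
  fil_desc : forall j, fil j.+1 `<=` fil j;
  fil_mul : forall j a x, n a -> fil j x -> fil j.+1 (a *: x)
}.

Definition stable (F : filtration) : Prop :=
  exists j0, forall j, (j0 <= j)%N -> smul n (F j) = F j.+1.

Definition pow_smul (j : nat) : set M := iter j (smul n) setT.

Lemma smul_submodule (I : set R) (A : set M) :
  submodule A -> submodule (smul I A).
Proof.
move=> [A0 AD AZ]; split.
- by exists [::]; rewrite big_nil.
- move=> x y [s [hs ->]] [t [ht ->]]; exists (s ++ t); rewrite big_cat.
  by split=> // p; rewrite mem_cat => /orP[/hs|/ht].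
- move=> a x [s [hs ->]]; exists [seq (p.1, a *: p.2) | p <- s]; split.
    by move=> _ /mapP[p /hs[? ?] ->]; split=> //; apply: AZ.
  rewrite big_map scaler_sumr; apply: eq_bigr => p _ /=.
  by rewrite !scalerA mulrC.
Qed.

Lemma smul_subset (I : set R) (A : set M) :
  submodule A -> smul I A `<=` A.
Proof.
move=> [A0 AD AZ] _ [s [hs ->]].
rewrite big_seq; elim/big_ind: _ => // p /hs[_ ?]; exact: AZ.
Qed.

Lemma pow_smul_submodule j : submodule (pow_smul j).
Proof. by elim: j => [|j IH]; [split | apply: smul_submodule]. Qed.

Lemma pow_smul_desc j : pow_smul j.+1 `<=` pow_smul j.
Proof. by apply: smul_subset; apply: pow_smul_submodule. Qed.

Lemma pow_smul_mul j a x : n a -> pow_smul j x -> pow_smul j.+1 (a *: x).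
Proof.
move=> na hx; exists [:: (a, x)]; rewrite big_seq1; split=> // p.
by rewrite inE => /eqP ->.
Qed.

Definition adic : filtration :=
  @Filtration pow_smul erefl pow_smul_submodule pow_smul_desc pow_smul_mul.

End Filtrations.

Arguments adic {R} n M.

(* The total space of gr_F (M): finitely supported sequences (x_j) with x_j in
   M_j, modulo those with x_j in M_(j+1) for all j. *)
Section GradedTotal.
Variables (R : comNzRingType) (n : set R) (M : lmodType R).
Variable F : filtration n M.

Definition fseq_pred : {pred (nat -> M)} := fun f =>
  `[< (forall j, F j (f j)) /\
      exists N, forall j, (N <= j)%N -> f j = 0 >].

Lemma fil_opp j x : F j x -> F j (- x).
Proof. by have [_ _ h] := fil_submodule F j; rewrite -scaleN1r; apply: h. Qed.

Lemma fil_add j x y : F j x -> F j y -> F j (x + y).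
Proof. by have [_ h _] := fil_submodule F j; apply: h. Qed.

Lemma fil_zero j : F j 0.
Proof. by have [] := fil_submodule F j. Qed.

Lemma fil_scale j a x : F j x -> F j (a *: x).
Proof. by have [_ _ h] := fil_submodule F j; apply: h. Qed.

Lemma fil_sum j I (r : seq I) (P : pred I) (E : I -> M) :
  (forall i, P i -> F j (E i)) -> F j (\sum_(i <- r | P i) E i).
Proof.
by move=> h; elim/big_ind: _ => //; [apply: fil_zero | move=> *; apply: fil_add].
Qed.

Lemma fseq_zmod_closed : zmod_closed fseq_pred.
Proof.
split; first by apply/asboolP; split=> [j|]; [apply: fil_zero | exists 0%N].
move=> f g /asboolP[hf [Nf sf]] /asboolP[hg [Ng sg]]; apply/asboolP; split.
  by move=> j; apply: fil_add => //; apply: fil_opp.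
exists (maxn Nf Ng) => j; rewrite geq_max => /andP[h1 h2].
change (f j - g j = 0); by rewrite sf // sg // subr0.
Qed.

HB.instance Definition _ :=
  GRing.isZmodClosed.Build (nat -> M) fseq_pred fseq_zmod_closed.

Record fseq := FSeq { fseq_val :> nat -> M; _ : fseq_pred fseq_val }.
HB.instance Definition _ := [isSub for fseq_val].
HB.instance Definition _ := [Choice of fseq by <:].
HB.instance Definition _ := [SubChoice_isSubZmodule of fseq by <:].

Definition fseq_null : {pred fseq} := fun f => `[< forall j, F j.+1 (f j) >].

Lemma fseq_null_zmod_closed : zmod_closed fseq_null.
Proof.
split; first by apply/asboolP => j; apply: fil_zero.
move=> f g /asboolP hf /asboolP hg; apply/asboolP => j.
by apply: fil_add => //; apply: fil_opp.
Qed.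

HB.instance Definition _ :=
  GRing.isZmodClosed.Build fseq fseq_null fseq_null_zmod_closed.

Definition gr : Type := {ideal_quot fseq_null}.
HB.instance Definition _ := GRing.Zmodule.on gr.
HB.instance Definition _ := EqQuotient.on gr.

Lemma gr_piD (f g : fseq) : \pi_gr (f + g) = \pi_gr f + \pi_gr g.
Proof. by rewrite -[RHS](Quotient.pi_add fseq_null). Qed.

Lemma fseqP (f : fseq) :
  (forall j, F j (f j)) /\ exists N, forall j, (N <= j)%N -> f j = 0.
Proof. by case: f => f /= /asboolP. Qed.

Lemma mono_subproof j (x : M) :
  fseq_pred (fun i => if i == j then if `[< F j x >] then x else 0 else 0).
Proof.
apply/asboolP; split=> [i|]; last first.
  by exists j.+1 => i; case: eqP => // ->; rewrite ltnn.
case: eqP => [->|_]; last exact: fil_zero.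
by case: asboolP => // _; apply: fil_zero.
Qed.

Definition mono j (x : M) : fseq := FSeq (mono_subproof j x).

(* The class of x in M_j / M_(j+1); it is 0 when x is not in M_j. *)
Definition symbol j (x : M) : gr := \pi_gr (mono j x).

Definition gr_deg (j : int) : set gr :=
  match j with
  | Posz i => [set z | exists2 x, F i x & z = symbol i x]
  | Negz _ => [set 0]
  end.

End GradedTotal.

Arguments gr_deg {R n M} F j.
Arguments symbol {R n M} F j x.

(* The action of gr_n (R) on gr_F (M), and the product of gr_n (R) as the
   special case M = R. *)
Section Action.
Variables (R : comNzRingType) (n : set R).
Notation A := (adic n R^o).

Section OneModule.
Variables (M : lmodType R) (F : filtration n M).

Lemma pow_fil i j a x : pow_smul n i (a : R^o) -> F j x -> F (i + j)%N (a *: x).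
Proof.
elim: i j a => [|i IH] j a ha hx; first exact: fil_scale.
case: ha => s [hs ->]; rewrite scaler_suml big_seq; apply: fil_sum => p /hs[h1 h2].
by rewrite -scalerA addSn; apply: fil_mul => //; apply: IH.
Qed.

Definition conv (f : nat -> R) (g : nat -> M) : nat -> M :=
  fun j => \sum_(i < j.+1) f i *: g (j - i)%N.

Lemma conv_subproof (f : fseq A) (g : fseq F) : fseq_pred F (conv f g).
Proof.
have [hf [Nf sf]] := fseqP f; have [hg [Ng sg]] := fseqP g.
apply/asboolP; split=> [j|].
  rewrite /conv; apply: (fil_sum (F := F)) => i _.
  have hij : (i + (j - i) = j)%N by rewrite subnKC // -ltnS.
  by have := pow_fil (hf i) (hg (j - i)%N); rewrite hij.
exists (Nf + Ng)%N => j hj; rewrite /conv big1 // => i _.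
have [hi|hi] := leqP Nf i; first by rewrite sf // scale0r.
rewrite sg ?scaler0 // leq_subRL; last by rewrite -ltnS.
by apply: leq_trans hj; rewrite leq_add2r ltnW.
Qed.

Definition act (f : fseq A) (g : fseq F) : fseq F := FSeq (conv_subproof f g).

Definition gr_scale (a : gr A) (x : gr F) : gr F :=
  \pi_(gr F) (act (repr a) (repr x)).

Lemma gr_eqP (f g : fseq F) :
  (forall j, F j.+1 (f j - g j)) <-> \pi_(gr F) f = \pi_(gr F) g.
Proof.
split=> [h|].
  by apply/eqP; rewrite -Quotient.idealrBE; apply/asboolP.
by move=> /eqP; rewrite -Quotient.idealrBE => /asboolP.
Qed.

Lemma gr_scaleE (f : fseq A) (g : fseq F) :
  gr_scale (\pi_(gr A) f) (\pi_(gr F) g) = \pi_(gr F) (act f g).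
Proof.
rewrite /gr_scale; set f' := repr _; set g' := repr _.
have ef j : pow_smul n j.+1 (f' j - f j : R^o).
  have : \pi_(gr A) f' = \pi_(gr A) f by rewrite /f' reprK.
  move/eqP; rewrite -Quotient.idealrBE => /asboolP; exact.
have eg j : F j.+1 (g' j - g j) by apply: (gr_eqP _ _).2; rewrite /g' reprK.
have [hf _] := fseqP f'; have [hg _] := fseqP g.
apply/gr_eqP => j /=; rewrite /conv -sumrB; apply: fil_sum => i _.
have hij : (i + (j - i) = j)%N by rewrite subnKC // -ltnS.
have -> : f' i *: g' (j - i)%N - f i *: g (j - i)%N =
  f' i *: (g' (j - i)%N - g (j - i)%N) + (f' i - f i) *: g (j - i)%N.
  by rewrite scalerBr scalerBl addrA subrK.
apply: fil_add.
  by have := pow_fil (hf i) (eg (j - i)%N); rewrite addnS hij.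
by have := pow_fil (ef i) (hg (j - i)%N); rewrite addSn hij.
Qed.


Lemma convS f g j : conv f g j.+1 = f 0%N *: g j.+1 + conv (fun i => f i.+1) g j.
Proof. by rewrite /conv big_ord_recl subn0; congr (_ + _). Qed.

Lemma conv_DZl c f f' g j :
  conv (fun i => c * f i + f' i) g j = c *: conv f g j + conv f' g j.
Proof.
rewrite /conv scaler_sumr -big_split; apply: eq_bigr => i _ /=.
by rewrite scalerDl scalerA.
Qed.

Lemma convDl f f' g j : conv (fun i => f i + f' i) g j = conv f g j + conv f' g j.
Proof. by rewrite /conv -big_split; apply: eq_bigr => i _ /=; rewrite scalerDl. Qed.

Lemma convDr f g g' j : conv f (fun i => g i + g' i) j = conv f g j + conv f g' j.
Proof. by rewrite /conv -big_split; apply: eq_bigr => i _ /=; rewrite scalerDr. Qed.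

Lemma conv1l f g : f 0%N = 1 -> (forall i, f i.+1 = 0) -> conv f g = g.
Proof.
move=> f0 fS; apply: funext => j; rewrite /conv big_ord_recl f0 scale1r subn0.
by rewrite big1 ?addr0 // => i _; rewrite fS scale0r.
Qed.

Lemma gr_pi (x : gr F) : exists f, x = \pi_(gr F) f.
Proof. by exists (repr x); rewrite reprK. Qed.

Definition gr_one : gr A := symbol A 0 1.

Lemma gr_scale1 : left_id gr_one gr_scale.
Proof.
move=> x; have [f ->] := gr_pi x; rewrite gr_scaleE; congr (\pi_(gr F) _).
apply: val_inj; apply: conv1l => //=; case: asboolP => // h; by case: h.
Qed.

Lemma gr_scaleDr : right_distributive gr_scale +%R.
Proof.
move=> a x y; have [f ->] := gr_pi x; have [g ->] := gr_pi y.
rewrite -[a]reprK -gr_piD !gr_scaleE -gr_piD; congr (\pi_(gr F) _).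
by apply: val_inj; apply: funext => j; apply: convDr.
Qed.

Lemma gr_scaleDl x : {morph gr_scale^~ x : a b / a + b}.
Proof.
move=> a b; have [f ->] := gr_pi x.
rewrite -[a]reprK -[b]reprK -gr_piD !gr_scaleE -gr_piD; congr (\pi_(gr F) _).
by apply: val_inj; apply: funext => j; apply: convDl.
Qed.

End OneModule.

Lemma conv_assoc (M : lmodType R) (f g : nat -> R) (h : nat -> M) j :
  conv (conv (M := R^o) f g) h j = conv f (conv g h) j.
Proof.
elim: j f => [|j IH] f; first by rewrite /conv !big_ord1 /= scalerA.
rewrite !convS scalerDr scalerA -addrA -IH -conv_DZl.
have c0 : conv (M := R^o) f g 0 = f 0%N * g 0%N by rewrite /conv big_ord1.
rewrite c0; congr (_ + _); rewrite [in RHS]/conv; apply: eq_bigr => i _.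
by rewrite convS.
Qed.

Lemma gr_scaleA (M : lmodType R) (F : filtration n M) (a b : gr A) (x : gr F) :
  gr_scale a (gr_scale b x) = gr_scale (gr_scale a b) x.
Proof.
have [f ->] := gr_pi x; have [g ->] := gr_pi b; have [h ->] := gr_pi a.
rewrite !gr_scaleE; congr (\pi_(gr F) _); apply: val_inj; apply: funext => j.
by rewrite /= conv_assoc.
Qed.

Lemma gr_mulC : commutative (@gr_scale R^o A).
Proof.
move=> a b; have [g ->] := gr_pi b; have [h ->] := gr_pi a.
rewrite !gr_scaleE; congr (\pi_(gr A) _); apply: val_inj; apply: funext => j.
rewrite /= /conv (reindex_inj rev_ord_inj); apply: eq_bigr => i _ /=.
by rewrite subSS subKn -1?ltnS // [LHS]mulrC.
Qed.

Definition gr_ring : Type := gr A.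
HB.instance Definition _ := GRing.Zmodule.on gr_ring.
HB.instance Definition _ := GRing.Zmodule_isComPzRing.Build gr_ring
  (@gr_scaleA R^o A) gr_mulC (@gr_scale1 R^o A)
  (fun a b x => @gr_scaleDl R^o A x a b).

HB.instance Definition _ (M : lmodType R) (F : filtration n M) :=
  GRing.Zmodule_isLmodule.Build gr_ring (gr F)
    (@gr_scaleA M F) (@gr_scale1 M F) (@gr_scaleDr M F) (@gr_scaleDl M F).

Lemma gr_scale_symbol (M : lmodType R) (F : filtration n M) i j a (x : M) :
  pow_smul n i (a : R^o) -> F j x ->
  (symbol A i a : gr_ring) *: symbol F j x = symbol F (i + j) (a *: x).
Proof.
move=> ha hx; rewrite [LHS]gr_scaleE; congr (\pi_(gr F) _).
apply: val_inj; apply: funext => k /=; rewrite /conv.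
rewrite (asboolT ha) (asboolT hx) (asboolT (pow_fil ha hx)).
have [lik|lki] := leqP i k; last first.
  rewrite big1 => [|l _]; first by rewrite ltn_eqF // ltn_addr.
  case: eqP => [e|_]; last by rewrite scale0r.
  by have := ltn_ord l; rewrite e ltnS leqNgt lki.
have hi : (i < k.+1)%N by [].
rewrite (bigD1 (Ordinal hi)) //= eqxx big1 => [|l].
  rewrite addr0 -(eqn_add2l i) subnKC //.
  by case: eqP => // _; rewrite scaler0.
by rewrite -val_eqE /= => /negPf ->; rewrite scale0r.
Qed.

Definition gr_ring_deg : int -> set gr_ring := gr_deg A.

End Action.

(* Graded Tor over a graded ring P = (+)_j P_j with P_0 = k = P / P_+.  A graded
   P-module is given by its homogeneous components N_j inside an ambient
   P-module, so that a graded submodule is a smaller family of components. *)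
Section GradedTor.
Variables (P : comPzRingType) (Pdeg : int -> set P).

Definition irrelevant : set P :=
  smul (M := P^o) setT [set x | exists2 j : int, (0 < j)%R & Pdeg j x].

(* A graded free resolution ... -> F_1 -> F_0 -> P / P_+ -> 0 by modules of
   finite rank.  F_i has basis elements indexed by 'I_(rk i), of degrees
   bdeg i b; elements of F_i are row vectors, differentials are matrices, and
   aug lists representatives in P of the images of the basis of F_0. *)
Record residue_resolution := ResidueResolution {
  rk : nat -> nat;
  bdeg : forall i, 'I_(rk i) -> int;
  aug : 'cV[P]_(rk 0%N);
  dif : forall i, 'M[P]_(rk i.+1, rk i);
  aug_homog : forall b, Pdeg (bdeg b) (aug b 0);
  dif_homog : forall i a b, Pdeg (bdeg a - bdeg b)%R (dif i a b);
  aug_onto : forall p : P, exists u : 'rV[P]_(rk 0%N),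
    irrelevant (p - (u *m aug) 0 0);
  aug_exact : forall u : 'rV[P]_(rk 0%N),
    irrelevant ((u *m aug) 0 0) <-> exists w, u = w *m dif 0%N;
  dif_exact : forall i (u : 'rV[P]_(rk i.+1)),
    u *m dif i = 0 <-> exists w, u = w *m dif i.+1
}.

Section Module.
Variables (V : lmodType P) (N : int -> set V).

Section Homology.
Variable F : residue_resolution.

(* The degree j part of F_i (x) N, where F_i = (+)_b P(- bdeg b). *)
Definition tens (i : nat) (j : int) : set ('I_(rk F i) -> V) :=
  [set v | forall b, N (j - bdeg b)%R (v b)].

Arguments tens : clear implicits.

Definition tens_dif (i : nat) (v : 'I_(rk F i.+1) -> V) : 'I_(rk F i) -> V :=
  fun b => \sum_a dif F i a b *: v a.

Definition tor_cycle (i : nat) : int -> set ('I_(rk F i) -> V) :=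
  match i with
  | 0%N => fun j => tens 0%N j
  | i'.+1 => fun j => [set v | tens i'.+1 j v /\ forall b, tens_dif v b = 0]
  end.

Arguments tor_cycle : clear implicits.

Definition tor_boundary (i : nat) (j : int) : set ('I_(rk F i) -> V) :=
  [set v | exists2 w, tens i.+1 j w & v = tens_dif w].

Arguments tor_boundary : clear implicits.

(* The b cycles z_l form a k-basis of H_i (F (x) N)_j modulo boundaries. *)
Definition tor_basis (i : nat) (j : int) (b : nat)
    (z : 'I_b -> 'I_(rk F i) -> V) : Prop :=
  [/\ forall l, tor_cycle i j (z l),
      forall v, tor_cycle i j v -> exists c : 'I_b -> P,
        (forall l, Pdeg 0 (c l)) /\
        tor_boundary i j (fun a => v a - \sum_l c l *: z l a) &
      forall c : 'I_b -> P, (forall l, Pdeg 0 (c l)) ->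
        tor_boundary i j (fun a => \sum_l c l *: z l a) ->
        forall l, c l = 0].

End Homology.

(* beta_(i,j) (N) = b.  Tor_i (k, N) does not depend on the resolution of k. *)
Definition betti (i : nat) (j : int) (b : nat) : Prop :=
  exists (F : residue_resolution) (z : 'I_b -> 'I_(rk F i) -> V), tor_basis j z.

Definition linear_resolution (d : int) : Prop :=
  forall (i : nat) (j : int), j <> (d + i%:Z)%R -> betti i j 0.

(* Homogeneous components of the submodule generated by N_d. *)
Definition component (d : int) : int -> set V :=
  fun j => N j `&` smul setT (N d).

End Module.

Definition componentwise_linear (V : lmodType P) (N : int -> set V) : Prop :=
  forall d : int, linear_resolution (component N d) d.

End GradedTor.

Arguments gr_ring_deg {R} n j.

Definition koszul (R : comNzRingType) (n : set R) (M : lmodType R) : Prop :=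
  fin_gen [set: M] /\
  linear_resolution (gr_ring_deg n) (gr_deg (adic n M)) 0.

(* Main.v *)
(** The hypotheses already force [P] to be a Koszul algebra: choose [d] with
    [G_d <> 0] and [G_(d+1) = P_1 G_d]; comparing the linear modules [G_<d>] and
    [P_+ G_<d>] shows that the residue field has a linear resolution
    [... -> P(-2)^b_2 -> P(-1)^b_1 -> P], and vanishing of Tor can be tested on
    it.  Its differentials are matrices of linear forms and lift to matrices [D]
    over [R] with entries in [n], with [D D] in [n^3].

    On the side of [M], [mu(M) = mu(gr M)] says that [n M /\ M_(t+1) = n M_t]
    for all [t], and linearity of the [G_<t>] propagates this to
    [n^s M /\ M_(s+t) = n^s M_t] for [s > 0].  Given [v] in [n^s M] with [D v] in
    [n^(s+2) M], suppose [v] in [n^s M_t].  Linearity of [G_<t-1>] corrects [v]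
    by an element of [n^(s+1) M] so that [D v] falls into [M_(s+t+2)]; linearity
    of [G_<t>] then writes [v = D w] modulo [M_(s+t+1)], and the error lies in
    [n^s M /\ M_(s+t+1) = n^s M_(t+1)].  Iterating until [M_t] is contained in
    [n M] shows that [gr_n(M)] is linear. *)

Require Import Defs.
From HB Require Import structures.
From mathcomp Require Import all_boot all_order all_algebra.
From mathcomp Require Import boolp classical_sets functions.
From mathcomp Require Import zify.
Set Implicit Arguments.
Unset Strict Implicit.
Unset Printing Implicit Defensive.
Import Order.TTheory GRing.Theory Num.Theory.
Local Open Scope ring_scope.
Local Open Scope classical_set_scope.
Local Open Scope quotient_scope.


(** * Linear algebra modulo a submodule *)

(** Comparing G_<d> with P_+ G_<d> means the long exact Tor sequence of 0 -> P_+ G_<d> -> G_<d> -> Q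
    -> 0, with Q a sum of copies of k(-d). The condition on d makes P_+ G_<d> equal to G_<d+1>, and
    then both neighbours of Tor_(i+1)(k, k(-d)) live in the single degree d + i + 1. The sequence is
    run on explicit vectors, because a Betti number is witnessed here by some resolution of k that
    may change with i and j. One fixed linear resolution absorbs all these witnesses, and its linear
    entries can be lifted to R. The lift D is no longer a complex: the exponents on the side of M
    come from D raising the order by one and D D by three instead of two. *)

Section Span.
Variables (S : comPzRingType) (V : lmodType S).
Implicit Types (A B : set V) (s : seq V).

Lemma submodule0 A : submodule A -> A 0. Proof. by case. Qed.
Lemma submoduleD A x y : submodule A -> A x -> A y -> A (x + y).
Proof. by case=> _ h _; apply: h. Qed.
Lemma submoduleZ A c x : submodule A -> A x -> A (c *: x).
Proof. by case=> _ _; apply. Qed.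
Lemma submoduleN A x : submodule A -> A x -> A (- x).
Proof. by move=> hA Ax; rewrite -scaleN1r; apply: submoduleZ. Qed.
Lemma submoduleB A x y : submodule A -> A x -> A y -> A (x - y).
Proof. by move=> hA Ax Ay; apply: submoduleD => //; apply: submoduleN. Qed.
Lemma submodule_sum A I (r : seq I) (P : pred I) (E : I -> V) :
  submodule A -> (forall i, P i -> A (E i)) -> A (\sum_(i <- r | P i) E i).
Proof.
move=> hA h; elim/big_ind: _ => //; first exact: submodule0.
by move=> x y; apply: submoduleD.
Qed.
Lemma submoduleBr A x y : submodule A -> A y -> A (x - y) -> A x.
Proof. by move=> hA Ay Axy; rewrite -(subrK y x); apply: submoduleD. Qed.
Lemma submodule_setT : submodule [set: V]. Proof. by []. Qed.
Lemma submodule_set0 : submodule [set 0 : V].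
Proof. by split=> //= [x y -> ->|a x ->]; rewrite ?addr0 ?scaler0. Qed.

Lemma smul_mem (I : set S) A a x : I a -> A x -> smul I A (a *: x).
Proof. by move=> Ia Ax; exists [:: (a, x)]; rewrite big_seq1; split=> // p /[!inE]/eqP->. Qed.

Lemma smul_min (I : set S) A B : submodule B ->
  (forall a x, I a -> A x -> B (a *: x)) -> smul I A `<=` B.
Proof.
move=> hB h _ [s [hs ->]]; rewrite big_seq; apply: submodule_sum => // p /hs[]; exact: h.
Qed.

Lemma smul_ideal_submodule (I : set S) A :
  (forall a p, I p -> I (a * p)) -> submodule (smul I A).
Proof.
move=> hI; split; first by exists [::]; rewrite big_nil.
- move=> x y [s [hs ->]] [t [ht ->]]; exists (s ++ t); rewrite big_cat.
  by split=> // p; rewrite mem_cat => /orP[/hs|/ht].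
- move=> a x [s [hs ->]]; exists [seq (a * p.1, p.2) | p <- s]; split.
    by move=> _ /mapP[p /hs[? ?] ->]; split=> //; apply: hI.
  rewrite big_map scaler_sumr; apply: eq_bigr => p _ /=.
  by rewrite scalerA.
Qed.

Lemma smul_setT_submodule A : submodule (smul setT A).
Proof. exact: smul_ideal_submodule. Qed.

Lemma smul_setT_mem A x : A x -> smul setT A x.
Proof. by move=> Ax; rewrite -[x]scale1r; apply: smul_mem. Qed.

(** Vectors are peeled off one at a time, so that exchange arguments become inductions on the list;
    carrying [A] along gives linear algebra in the quotient by [A] without forming it. *)
Fixpoint span_over A s : set V :=
  if s is x :: s' then [set v | exists c : S, span_over A s' (v - c *: x)] else A.

Lemma span_submodule A s : submodule A -> submodule (span_over A s).
Proof.
move=> hA; elim: s => [//|x s IH]; split=> /=.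
- by exists 0; rewrite scale0r subr0; apply: submodule0.
- move=> u v [c hc] [d hd]; exists (c + d).
  by rewrite scalerDl opprD addrACA; apply: submoduleD.
- move=> a u [c hc]; exists (a * c).
  by rewrite -scalerA -scalerBr; apply: submoduleZ.
Qed.

Lemma span_base A s : submodule A -> A `<=` span_over A s.
Proof.
move=> hA; elim: s => [//|x s IH] v Av /=; exists 0.
by rewrite scale0r subr0; apply: IH.
Qed.

Lemma span_mem A s x : submodule A -> x \in s -> span_over A s x.
Proof.
move=> hA; elim: s => [//|y s IH]; rewrite inE => /orP[/eqP <-|/IH h] /=.
  by exists 1; rewrite scale1r subrr; apply: submodule0; apply: span_submodule.
by exists 0; rewrite scale0r subr0.
Qed.

Lemma span_min A B s : submodule B -> A `<=` B ->
  (forall x, x \in s -> B x) -> span_over A s `<=` B.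
Proof.
move=> hB AB; elim: s => [//|x s IH] hs v [c hc].
apply: (@submoduleBr _ _ (c *: x)) => //.
  by apply: submoduleZ => //; apply: hs; rewrite mem_head.
by apply: IH hc => y ys; apply: hs; rewrite inE ys orbT.
Qed.

Lemma span_consA A x s : submodule A ->
  span_over (span_over A [:: x]) s = span_over A (x :: s).
Proof.
move=> hA; apply/seteqP; split.
  apply: span_min; first exact: span_submodule.
    apply: span_min; [exact: span_submodule | exact: span_base|].
    by move=> y; rewrite inE => /eqP->; apply: span_mem => //; rewrite mem_head.
  by move=> y ys; apply: span_mem => //; rewrite inE ys orbT.
have hA1 : submodule (span_over A [:: x]) by apply: span_submodule.
apply: span_min; first exact: span_submodule.
  by apply: subset_trans (span_base _ _) => //; apply: span_base.
move=> y; rewrite inE => /orP[/eqP->|ys]; last exact: span_mem.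
by apply: span_base => //; apply: span_mem => //; rewrite mem_head.
Qed.

Lemma span_codom m (x : 'I_m -> V) :
  span_over [set 0] [seq x l | l <- enum 'I_m] =
  [set y | exists c : 'I_m -> S, y = \sum_(l < m) c l *: x l].
Proof.
have h0 := submodule_set0; apply/seteqP; split.
  apply: span_min.
  - split=> [|u v [c ->] [d ->]|a u [c ->]].
    + by exists (fun=> 0); rewrite big1 // => l _; rewrite scale0r.
    + exists (fun l => c l + d l); rewrite -big_split; apply: eq_bigr => l _.
      by rewrite scalerDl.
    + exists (fun l => a * c l); rewrite scaler_sumr; apply: eq_bigr => l _.
      by rewrite scalerA.
  - by move=> _ ->; exists (fun=> 0); rewrite big1 // => l _; rewrite scale0r.
  - move=> _ /mapP[l _ ->]; exists (fun k => (k == l)%:R).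
    rewrite (bigD1 l) //= eqxx scale1r big1 ?addr0 // => k /negPf->.
    by rewrite scale0r.
move=> _ [c ->]; have hs := span_submodule [seq x l | l <- enum 'I_m] h0.
apply: submodule_sum => // l _; apply: submoduleZ => //; apply: span_mem => //.
by apply: map_f; rewrite mem_enum.
Qed.

Lemma generated_by_span A m : generated_by A m ->
  exists s, size s = m /\ A = span_over [set 0] s.
Proof.
case=> x ->; exists [seq x l | l <- enum 'I_m].
by rewrite size_map size_enum_ord span_codom.
Qed.

Lemma span_generated_by s : generated_by (span_over [set 0] s) (size s).
Proof.
exists (fun l : 'I_(size s) => nth 0 s l); rewrite -span_codom.
congr span_over; rewrite -[in LHS](mkseq_nth 0 s) /mkseq -val_enum_ord.
by rewrite -map_comp; apply: eq_map.
Qed.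

Section Exchange.
(* [S / I] is a field. *)
Variables (I : set S) (hI : forall p, I p \/ exists q, I (q * p - 1)).

(** Modulo [I] the coefficient [c] is zero or invertible: in the first case [c *: x] dies modulo
    [A], in the second [x] can be solved for. *)
Lemma exchange A x y c : submodule A ->
  (forall p, I p -> A (p *: x)) ->
  A (y - c *: x) -> A y \/ exists q, A (x - q *: y).
Proof.
move=> hA hx h; have [Ic|[q hq]] := hI c.
  by left; apply: (@submoduleBr _ _ (c *: x)) => //; apply: hx.
right; exists q; have := submoduleD hA (submoduleZ q hA h) (hx _ hq).
rewrite scalerBr scalerA scalerBl scale1r addrA subrK => h'.
by rewrite -opprB; apply: submoduleN.
Qed.

(** [A'] plays the kernel of a linear form over the residue field with value 1 at [x]; the scalars
    [c] are its values on [T]. Each [w] in [T] is added to the kernel unless this would capture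
    [x]. *)
Lemma hyperplane A x (T : seq V) : submodule A ->
  (forall w p, w \in x :: T -> I p -> A (p *: w)) -> ~ A x ->
  exists A', [/\ submodule A', A `<=` A', ~ A' x &
    forall w, w \in T -> exists c : S, A' (w - c *: x)].
Proof.
move=> hA; elim: T => [|w T IH] hT nAx; first by exists A; split.
have [|A' [hA' AA' nx h]] := IH _ nAx.
  move=> v p vT Ip; apply: hT => //; move: vT; rewrite !inE.
  by case/orP=> ->; rewrite ?orbT.
have [wx|nwx] := pselect (span_over A' [:: w] x).
  case: wx => c /= hc; exists A'; split=> // v; rewrite inE => /orP[/eqP->|/h//].
  have := @exchange A' w x c hA' _ hc; case=> // p Ip; apply: AA'; apply: hT => //.
  by rewrite !inE eqxx orbT.
exists (span_over A' [:: w]); split=> //; first exact: span_submodule.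
  by apply: subset_trans (span_base _ _).
move=> v; rewrite inE => /orP[/eqP->|/h[c hc]].
  by exists 0; rewrite scale0r subr0; apply: span_mem => //; rewrite mem_head.
by exists c; apply: span_base.
Qed.

(** As [x] is nonzero modulo [A], some vector of [s] enters it with an invertible coefficient and
    can be traded for [x]. *)
Lemma span_remove A x s : submodule A ->
  (forall w p, I p -> A (p *: w)) -> span_over A s x -> ~ A x ->
  exists s', size s = (size s').+1 /\ span_over A s `<=` span_over A (x :: s').
Proof.
move=> hA hIA; elim: s => [//|y s IH] hx nAx.
have hAs := span_submodule s hA; have hIAs w p : I p -> span_over A s (p *: w).
  by move=> Ip; apply: span_base => //; apply: hIA.
have [xs|nxs] := pselect (span_over A s x).
  have [s' [hs' sub]] := IH xs nAx; exists (y :: s'); split; first by rewrite /= hs'.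
  apply: span_min; [exact: span_submodule | exact: span_base|].
  move=> z; rewrite inE => /orP[/eqP->|zs].
    by apply: span_mem => //; rewrite !inE eqxx orbT.
  have /sub h := span_mem hA zs; apply: (span_min _ _ _ h); [exact: span_submodule |
    exact: span_base|].
  move=> u; rewrite inE => /orP[/eqP->|us]; apply: span_mem => //.
    by rewrite mem_head.
  by rewrite !inE us !orbT.
case: hx => c hc; have [//|[q hq]] := @exchange _ y x c hAs (hIAs y) hc.
exists s; split=> //; apply: span_min; [exact: span_submodule | exact: span_base|].
move=> z; rewrite inE => /orP[/eqP->|zs]; first by exists q.
by apply: span_mem => //; rewrite inE zs orbT.
Qed.

(* Steinitz exchange of a spanning sequence by elements of [T]. *)
Lemma span_replace A (T : set V) s : submodule A ->
  (forall w p, I p -> A (p *: w)) ->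
  (forall B, submodule B -> A `<=` B -> T `<=` B -> B = setT) ->
  span_over A s = setT ->
  exists s', [/\ (size s' <= size s)%N, forall x, x \in s' -> T x & span_over A s' = setT].
Proof.
move=> hA hIA hT; elim: s A hA hIA hT => [|y s IH] A hA hIA hT hs.
  by exists [::].
have hAy := span_submodule [:: y] hA.
have sAy := @span_base A [:: y] hA.
have [||||s' [hs' s'T e]] := IH (span_over A [:: y]).
- exact: hAy.
- by move=> w p Ip; apply: sAy; apply: hIA.
- by move=> B hB AB TB; apply: hT => // v Av; apply: AB; apply: sAy.
- by rewrite span_consA.
have hAs := span_submodule s' hA.
have [TA|nTA] := pselect (T `<=` span_over A s').
  by exists s'; split=> //; [rewrite leqW | apply: hT => //; apply: span_base].
have [t Tt nt] : exists2 t, T t & ~ span_over A s' t.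
  by apply: contra_notP nTA => h t Tt; apply: contra_notP h => nt; exists t.
exists (t :: s'); split=> //.
  by move=> x; rewrite inE => /orP[/eqP->|/s'T].
have hy p : I p -> span_over A s' (p *: y).
  by move=> Ip; apply: span_base => //; apply: hIA.
have : span_over A (y :: s') t by rewrite -span_consA // e.
case=> c hc; have [//|[q hq]] := @exchange _ y t c hAs hy hc.
apply/seteqP; split=> // z _.
have h : span_over A (y :: s') z by rewrite -span_consA // e.
apply: (span_min _ _ _ h); [exact: span_submodule | exact: span_base|].
move=> u; rewrite inE => /orP[/eqP->|us]; first by exists q.
by apply: span_mem => //; rewrite inE us orbT.
Qed.

End Exchange.
End Span.

(** * Submodules of finitely generated modules over a noetherian ring *)

Section Noetherian.
Variables (R : comNzRingType) (hR : noetherian R) (V : lmodType R).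

(** The coefficients of elements of [B] at the first vector form an ideal. Lifts of its generators,
    together with generators of the part of [B] in the span of the other vectors, generate [B]. *)
Lemma noetherian_span (e : seq V) (B : set V) : submodule B ->
  B `<=` span_over [set 0] e -> exists s, B = span_over [set 0] s.
Proof.
elim: e B => [|x e IH] B hB hBe.
  exists [::]; apply/seteqP; split=> // _ ->; exact: submodule0.
have h0 := @submodule_set0 _ V; have hE := span_submodule e h0.
pose I : set R := [set c | exists2 v, span_over [set 0] e v & B (c *: x + v)].
have hIi : ideal I.
  split.
  - by exists 0; rewrite ?scale0r ?addr0; apply: submodule0.
  - move=> c d [u hu Bu] [v hv Bv]; exists (u + v); first exact: submoduleD.
    by rewrite scalerDl addrACA; apply: submoduleD.
  - move=> a c [u hu Bu]; exists (a *: u); first exact: submoduleZ.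
    by rewrite -[a *: c]/(a * c) -scalerA -scalerDr; apply: submoduleZ.
have [m [c hc]] := hR hIi.
have /choice[u hu] l : exists u, span_over [set 0] e u /\ B (c l *: x + u).
  have : I (c l).
    rewrite hc; exists (fun k => (k == l)%:R).
    rewrite (bigD1 l) //= eqxx scale1r big1 ?addr0 // => k /negPf->.
    by rewrite scale0r.
  by case=> u hu Bu; exists u.
have [|v [Bv ev]|t ht] := IH (B `&` span_over [set 0] e).
- split; first by split; apply: submodule0.
    by move=> y z [? ?] [? ?]; split; apply: submoduleD.
  by move=> a y [? ?]; split; apply: submoduleZ.
- exact: ev.
pose g := [seq c l *: x + u l | l <- enum 'I_m].
have sub v : v \in t -> B v /\ span_over [set 0] e v.
  by move=> vt; suff: (B `&` span_over [set 0] e) v by []; rewrite ht; apply: span_mem.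
have h1 : submodule (span_over [set 0] (g ++ t)) by apply: span_submodule.
exists (g ++ t); apply/seteqP; split=> [y By|]; last first.
  apply: span_min => // [_ ->|y]; first exact: submodule0.
  by rewrite mem_cat => /orP[/mapP[l _ ->]|/sub[]//]; case: (hu l).
have [a ha] := hBe _ By; have : I a by exists (y - a *: x); rewrite // addrC subrK.
rewrite hc => -[d hd].
have : (B `&` span_over [set 0] e) (y - \sum_l d l *: (c l *: x + u l)).
  split.
    apply: submoduleB => //; apply: submodule_sum => // l _; apply: submoduleZ => //.
    by case: (hu l).
  have -> : \sum_l d l *: (c l *: x + u l) = a *: x + \sum_l d l *: u l.
    rewrite hd scaler_suml -big_split; apply: eq_bigr => l _ /=.
    by rewrite scalerDr scalerA.
  rewrite opprD addrA; apply: submoduleB => //; apply: submodule_sum => // l _.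
  by apply: submoduleZ => //; case: (hu l).
rewrite ht => h; apply: submoduleBr (span_min h1 _ _ h) => //.
- apply: submodule_sum => // l _; apply: submoduleZ => //; apply: span_mem => //.
  by rewrite mem_cat; apply/orP; left; apply/mapP; exists l; rewrite ?mem_enum.
- by move=> _ ->; apply: submodule0.
- by move=> z zt; apply: span_mem => //; rewrite mem_cat zt orbT.
Qed.

End Noetherian.

(** * Units of a local ring and Nakayama's lemma *)

Section Local.
Variables (R : comNzRingType) (n : set R) (hn : local_ring n).

Lemma local_ideal : ideal n. Proof. by case: hn => -[]. Qed.

Lemma local_not1 : ~ n 1.
Proof.
case: hn => -[hi nT _] _ n1; apply: nT; apply/seteqP; split=> // x _.
by rewrite -[x]mulr1; apply: (submoduleZ x hi n1).
Qed.

Lemma local_unit a : ~ n a -> exists b, b * a = 1.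
Proof.
move=> na; apply: contrapT => nb.
pose P (A : set R) := A = set0 \/ [/\ ideal A, A a & ~ A 1].
have [|Z [PZ maxZ]] := @Zorn_bigcup R P.
  move=> C CP tot.
  have [[A [CA Aa]]|hC] := pselect (exists A, C A /\ A a); last first.
    left; rewrite -subset0 => x [A CA Ax]; apply: hC; exists A; split=> //.
    by have [A0|[]//] := CP _ CA; move: Ax; rewrite A0.
  have h B : C B -> B !=set0 -> [/\ ideal B, B a & ~ B 1].
    by move=> /CP[->|//] [].
  have hA : ideal A by have [] := h A CA (ex_intro _ a Aa).
  right; split.
  - split; first by exists A => //; apply: submodule0 hA.
      move=> x y [B CB Bx] [D CD Dy]; have [hB _ _] := h B CB (ex_intro _ x Bx).
      have [hD _ _] := h D CD (ex_intro _ y Dy).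
      have [BD|DB] := tot _ _ CB CD; [exists D|exists B] => //.
        by apply: (submoduleD hD) => //; apply: BD.
      by apply: (submoduleD hB) => //; apply: DB.
    move=> c x [B CB Bx]; have [hB _ _] := h B CB (ex_intro _ x Bx).
    by exists B => //; apply: (submoduleZ c hB).
  - by exists A.
  - by move=> [B CB B1]; have [_ _] := h B CB (ex_intro _ 1 B1).
pose J : set R := [set x | exists b, x = b * a].
have hJ : P J.
  right; split.
  - split; first by exists 0; rewrite mul0r.
      by move=> _ _ [b ->] [c ->]; exists (b + c); rewrite mulrDl.
    by move=> c _ [b ->]; exists (c * b); rewrite -mulrA.
  - by exists 1; rewrite mul1r.
  - by move=> [b hb]; apply: nb; exists b.
have {PZ} [hZ Za nZ1] : [/\ ideal Z, Z a & ~ Z 1].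
  case: PZ => // Z0; exfalso; apply: (maxZ J _ hJ); rewrite Z0.
  by split=> // h; apply: (h a); exists 1; rewrite mul1r.
have mZ : maximal_ideal Z.
  split=> // [ZT|K hK ZK]; first by apply: nZ1; rewrite ZT.
  have [K1|nK1] := pselect (K 1).
    right; apply/seteqP; split=> // x _; rewrite -[x]mulr1; exact: (submoduleZ x hK K1).
  left; apply: contrapT => ne; apply: (maxZ K).
    split=> // KZ; apply: ne; exact/seteqP.
  by right; split=> //; apply: ZK.
by case: hn => _ /(_ _ mZ) e; apply: na; rewrite -e.
Qed.

Lemma local_unit_1sub a : n a -> exists b, b * (1 - a) = 1.
Proof.
move=> na; apply: local_unit => h; apply: local_not1.
by rewrite -(subrK a 1); apply: (submoduleD local_ideal).
Qed.

(** One generator is dropped at a time: writing [y] as an element of [X] plus one of n V leaves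
    [(1 - c) *: y] in the span of the others with [c] in n, and [1 - c] is a unit. *)
Lemma nakayama (V : lmodType R) (X : set V) (e : seq V) : submodule X ->
  span_over X e = setT -> (forall v, exists x y, [/\ v = x + y, X x & smul n setT y]) ->
  X = setT.
Proof.
move=> hX; elim: e => [//|y e IH] he hv; apply: IH => //.
have hXe := span_submodule e hX; have nid := local_ideal.
have [x [z [yE Xx nz]]] := hv y.
have [c nc hc] : exists2 c, n c & span_over X e (z - c *: y).
  have hB : submodule [set v | exists2 c, n c & span_over X e (v - c *: y)].
    split.
    - by exists 0; [apply: submodule0 nid | rewrite scale0r subr0; apply: submodule0].
    - move=> u v [c nc hc] [d nd hd]; exists (c + d); first exact: submoduleD nid _ _.
      by rewrite scalerDl opprD addrACA; apply: submoduleD.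
    - move=> a u [c nc hc]; exists (a * c); first exact: submoduleZ nid _.
      by rewrite -scalerA -scalerBr; apply: submoduleZ.
  apply: (smul_min hB _ nz) => a v na _; have : span_over X (y :: e) v by rewrite he.
  case=> c hc; exists (a * c); last by rewrite -scalerA -scalerBr; apply: submoduleZ.
  by rewrite mulrC; apply: submoduleZ nid _.
have [b hb] := local_unit_1sub nc.
have hy : span_over X e y.
  rewrite -[y]scale1r -hb -scalerA; apply: submoduleZ => //.
  rewrite scalerBl scale1r [X in X - _]yE -addrA; apply: submoduleD => //.
  exact: span_base.
apply/seteqP; split=> // v _; have h : span_over X (y :: e) v by rewrite he.
apply: (span_min _ _ _ h) => //; first exact: span_base.
by move=> u /[!inE]/orP[/eqP->//|ue]; apply: span_mem.
Qed.

End Local.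

(** * Graded modules and homogeneous complexes *)

(* [pr] and [pv] are the projections of the ring and of the module onto their
   homogeneous components. *)
Record graded_module (P : comPzRingType) (Pd : int -> set P) (V : lmodType P)
    (N : int -> set V) (pr : int -> P -> P) (pv : int -> V -> V) : Prop :=
  GradedModule {
  hom0 : forall e, N e 0;
  homB : forall e x y, N e x -> N e y -> N e (x - y);
  homZ : forall e f p x, Pd e p -> N f x -> N (e + f) (p *: x);
  hom_neg : forall e x, (e < 0)%R -> N e x -> x = 0;
  prB : forall e x y, pv e (x - y) = pv e x - pv e y;
  pr_hom : forall e x, N e (pv e x);
  pr_id : forall e x, N e x -> pv e x = x;
  pr_ne : forall e f x, N f x -> e <> f -> pv e x = 0;
  prZ : forall e f p x, Pd e p -> pv (e + f) (p *: x) = p *: pv f x;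
  prZr : forall e f p x, N f x -> pv (e + f) (p *: x) = pr e p *: x;
  pr_sum : forall x, exists k, forall k', (k <= k')%N ->
    x = \sum_(e < k') pv e%:Z x
}.

Section GradedModuleTheory.
Variables (P : comPzRingType) (Pd : int -> set P) (V : lmodType P).
Variables (N : int -> set V) (pr : int -> P -> P) (pv : int -> V -> V).
Hypothesis (hN : graded_module Pd N pr pv).

Lemma homN e x : N e x -> N e (- x).
Proof. by move=> h; rewrite -[- x]add0r; apply: (homB hN) => //; apply: hom0 hN _. Qed.
Lemma homD e x y : N e x -> N e y -> N e (x + y).
Proof. by move=> hx hy; rewrite -[y]opprK; apply: (homB hN) => //; apply: homN. Qed.
Lemma hom_sum e I (r : seq I) (Q : pred I) (E : I -> V) :
  (forall i, Q i -> N e (E i)) -> N e (\sum_(i <- r | Q i) E i).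
Proof.
by move=> h; elim/big_ind: _ => //; [exact: hom0 hN _ | exact: homD].
Qed.
Lemma pr0 e : pv e 0 = 0.
Proof. by apply: (pr_id hN); apply: hom0 hN _. Qed.
Lemma prN e x : pv e (- x) = - pv e x.
Proof. by rewrite -[- x]add0r (prB hN) pr0 add0r. Qed.
Lemma prD e x y : pv e (x + y) = pv e x + pv e y.
Proof. by rewrite -{1}[y]opprK (prB hN) prN opprK. Qed.
Lemma prs e I (r : seq I) (Q : pred I) (E : I -> V) :
  pv e (\sum_(i <- r | Q i) E i) = \sum_(i <- r | Q i) pv e (E i).
Proof. by elim/big_rec2: _ => [|i x y _ <-]; [exact: pr0 | exact: prD]. Qed.
End GradedModuleTheory.

(** [gr_fg] is the finiteness used to build a resolution: the linear forms in a submodule of a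
    finite free module are spanned over P_0 by finitely many. It fits kernels that are generated by
    linear forms. *)
Record graded_ring (P : comPzRingType) (Pd : int -> set P) (pr : int -> P -> P) : Prop :=
  GradedRing {
  gr_mod : @graded_module P Pd P^o Pd pr pr;
  gr_hom1 : Pd 0 1;
  gr_irr : forall p, irrelevant Pd p <-> pr 0 p = 0;
  gr_field : forall p, Pd 0 p -> p = 0 \/ exists2 q, Pd 0 q & q * p = 1;
  gr_std : forall e p, (0 < e)%R -> Pd e p -> smul setT (Pd 1 : set P^o) p;
  gr_fg : forall b (Z : set 'rV[P]_b), submodule Z ->
    exists m (D : 'M[P]_(m, b)), [/\ forall a c, Pd 1 (D a c), forall a, Z (row a D) &
      forall z, Z z -> (forall c, Pd 1 (z 0 c)) ->
        exists2 w : 'rV[P]_m, forall a, Pd 0 (w 0 a) & z = w *m D]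
}.

Section GradedRing.
Variables (P : comPzRingType) (Pd : int -> set P) (pr : int -> P -> P).
Hypothesis hP : graded_ring Pd pr.
Let hPm := gr_mod hP.

Lemma rhom0 e : Pd e 0. Proof. exact: (hom0 hPm). Qed.
Lemma rhomB e p q : Pd e p -> Pd e q -> Pd e (p - q). Proof. exact: (homB hPm). Qed.
Lemma rhomM e f p q : Pd e p -> Pd f q -> Pd (e + f) (p * q).
Proof. exact: (homZ hPm). Qed.
Lemma rhom_neg e p : e < 0 -> Pd e p -> p = 0. Proof. exact: (hom_neg hPm). Qed.
Lemma rhom_sum e I (r : seq I) (Q : pred I) (E : I -> P) :
  (forall i, Q i -> Pd e (E i)) -> Pd e (\sum_(i <- r | Q i) E i).
Proof. exact: (hom_sum hPm). Qed.
Lemma rpr_hom e p : Pd e (pr e p). Proof. exact: (pr_hom hPm). Qed.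
Lemma rpr_neg e p : e < 0 -> pr e p = 0.
Proof. by move=> e0; apply: (rhom_neg e0); apply: rpr_hom. Qed.
Lemma rpr_id e p : Pd e p -> pr e p = p. Proof. exact: (pr_id hPm). Qed.
Lemma rpr_ne e f p : Pd f p -> e <> f -> pr e p = 0. Proof. exact: (pr_ne hPm). Qed.
Lemma rpr0 e : pr e 0 = 0. Proof. exact: (pr0 hPm). Qed.
Lemma rprB e p q : pr e (p - q) = pr e p - pr e q. Proof. exact: (prB hPm). Qed.
Lemma rpr_sum e I (r : seq I) (Q : pred I) (E : I -> P) :
  pr e (\sum_(i <- r | Q i) E i) = \sum_(i <- r | Q i) pr e (E i).
Proof. exact: (prs hPm). Qed.
Lemma rprM e f p q : Pd e p -> pr (e + f) (p * q) = p * pr f q.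
Proof. exact: (prZ hPm). Qed.

Section HomogeneousMatrices.
Definition homog_mx a b (gA : 'I_a -> int) (gB : 'I_b -> int) (M : 'M[P]_(a, b)) :=
  forall i j, Pd (gA i - gB j) (M i j).

Lemma homog_mxM a b c (gA : 'I_a -> int) (gB : 'I_b -> int) (gC : 'I_c -> int) M M' :
  homog_mx gA gB M -> homog_mx gB gC M' -> homog_mx gA gC (M *m M').
Proof.
move=> h h' i j; rewrite mxE; apply: rhom_sum => k _.
have -> : gA i - gC j = (gA i - gB k) + (gB k - gC j) by rewrite addrA subrK.
exact: rhomM.
Qed.

Definition homog_row b (g : 'I_b -> int) e (u : 'rV[P]_b) := homog_mx (fun=> e) g u.
Definition row_proj b (g : 'I_b -> int) e (u : 'rV[P]_b) : 'rV[P]_b :=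
  \row_c pr (e - g c) (u 0 c).

Lemma row_proj_homog b (g : 'I_b -> int) e u : homog_row g e (row_proj g e u).
Proof. by move=> i c; rewrite mxE; apply: rpr_hom. Qed.

Lemma row_proj_id b (g : 'I_b -> int) e u : homog_row g e u -> row_proj g e u = u.
Proof.
by move=> h; apply/rowP => c; rewrite mxE; apply: rpr_id; apply: h.
Qed.

Lemma row_projM a b (gA : 'I_a -> int) (gB : 'I_b -> int) M e u : homog_mx gA gB M ->
  row_proj gB e (u *m M) = row_proj gA e u *m M.
Proof.
move=> hM; apply/rowP => c; rewrite !mxE rpr_sum; apply: eq_bigr => i _.
rewrite mxE mulrC [RHS]mulrC -(rprM _ _ (hM i c)); congr (pr _ _).
by lia.
Qed.

(** A homogeneous matrix commutes with projection to a degree, so any preimage may be replaced by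
    its projection. *)
Lemma homog_row_lift a b (gA : 'I_a -> int) (gB : 'I_b -> int) M e u : homog_mx gA gB M ->
  homog_row gB e u -> (exists w, u = w *m M) -> exists2 w, homog_row gA e w & u = w *m M.
Proof.
move=> hM hu [w uw]; exists (row_proj gA e w); first exact: row_proj_homog.
by rewrite -(row_projM _ _ hM) -uw row_proj_id.
Qed.
End HomogeneousMatrices.

(* Complexes of finite free graded modules, with no exactness required; an
   initial segment of a resolution is such a complex. *)
Record cplx := Cplx {
  crk : nat -> nat;
  cbd : forall i, 'I_(crk i) -> int;
  cau : 'cV[P]_(crk 0%N);
  cdf : forall i, 'M[P]_(crk i.+1, crk i);
  cau_h : forall b, Pd (cbd b) (cau b 0);
  cdf_h : forall i, homog_mx (@cbd i.+1) (@cbd i) (cdf i)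
}.
Arguments cbd : clear implicits.
Arguments cau_h : clear implicits.
Arguments cdf_h : clear implicits.

(** Exactness at the places 0, ..., N - 1, besides surjectivity of the augmentation. Only [cdf C i]
    with i < N is constrained, so the notion applies to a resolution still under construction. *)
Definition exact_upto N (C : cplx) : Prop :=
  [/\ forall p : P, exists u : 'rV_(crk C 0), irrelevant Pd (p - (u *m cau C) 0 0),
   (0 < N)%N -> forall u : 'rV_(crk C 0),
    irrelevant Pd ((u *m cau C) 0 0) <-> exists w, u = w *m cdf C 0 &
   forall i, (i.+1 < N)%N -> forall u : 'rV_(crk C i.+1),
    u *m cdf C i = 0 <-> exists w, u = w *m cdf C i.+1].

Definition of_res (F : residue_resolution Pd) : cplx :=
  @Cplx (rk F) (@bdeg _ _ F) (aug F) (@dif _ _ F) (@aug_homog _ _ F)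
    (@dif_homog _ _ F).

Lemma of_res_exact F N : exact_upto N (of_res F).
Proof.
split=> [p|_ u|i _ u]; [exact: aug_onto | exact: aug_exact | exact: dif_exact].
Qed.

Lemma exact_dd N C i : exact_upto N C -> (i.+1 < N)%N -> cdf C i.+1 *m cdf C i = 0.
Proof.
case=> _ _ h lt; apply/row_matrixP => a; rewrite row_mul row0; apply/(h i lt).
by exists (delta_mx 0 a); rewrite rowE.
Qed.

Lemma exact_da N C : exact_upto N C -> (0 < N)%N ->
  forall a, irrelevant Pd ((cdf C 0 *m cau C) a 0).
Proof.
case=> _ h _ lt a; have -> : (cdf C 0 *m cau C) a 0 = (row a (cdf C 0) *m cau C) 0 0.
  by rewrite -row_mul [RHS]mxE.
by apply/(h lt); exists (delta_mx 0 a); rewrite rowE.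
Qed.

Definition chain_map N (A B : cplx) (f : forall i, 'M[P]_(crk A i, crk B i)) :=
  [/\ forall i, (i <= N)%N -> homog_mx (cbd A i) (cbd B i) (f i),
   forall a, irrelevant Pd ((f 0%N *m cau B - cau A) a 0) &
   forall i, (i < N)%N -> f i.+1 *m cdf B i = cdf A i *m f i].

Arguments chain_map : clear implicits.

Lemma irrelevantB p q : irrelevant Pd p -> irrelevant Pd q -> irrelevant Pd (p - q).
Proof. by move=> /(gr_irr hP) hp /(gr_irr hP) hq; apply/(gr_irr hP); rewrite rprB hp hq subrr. Qed.
Lemma irrelevantN p : irrelevant Pd p -> irrelevant Pd (- p).
Proof.
move=> hp; rewrite -[- p]add0r; apply: irrelevantB => //.
by apply/(gr_irr hP); rewrite rpr0.
Qed.
Lemma irrelevantD p q : irrelevant Pd p -> irrelevant Pd q -> irrelevant Pd (p + q).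
Proof. by move=> hp hq; rewrite -[q]opprK; apply: irrelevantB => //; apply: irrelevantN. Qed.
Lemma irrelevantM p q : irrelevant Pd q -> irrelevant Pd (p * q).
Proof. exact: submoduleZ (smul_setT_submodule _). Qed.
Lemma irrelevant_sum I (r : seq I) (Q : pred I) (E : I -> P) :
  (forall i, Q i -> irrelevant Pd (E i)) -> irrelevant Pd (\sum_(i <- r | Q i) E i).
Proof.
move=> h; elim/big_ind: _ => //; first by apply/(gr_irr hP); rewrite rpr0.
exact: irrelevantD.
Qed.
Lemma irrelevant0 p : Pd 0 p -> irrelevant Pd p -> p = 0.
Proof. by move=> hp /(gr_irr hP); rewrite rpr_id. Qed.

Lemma chain_map_comp N A B C f g : chain_map N A B f -> chain_map N B C g ->
  chain_map N A C (fun i => f i *m g i).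
Proof.
move=> [f1 f2 f3] [g1 g2 g3]; split=> [i le|a|i lt].
- by apply: homog_mxM; [apply: f1 | apply: g1].
- have -> : f 0%N *m g 0%N *m cau C - cau A =
    f 0%N *m (g 0%N *m cau C - cau B) + (f 0%N *m cau B - cau A).
    by rewrite mulmxBr addrA subrK mulmxA.
  rewrite mxE; apply: irrelevantD => //; rewrite mxE; apply: irrelevant_sum => b _.
  exact: irrelevantM.
- by rewrite -mulmxA g3 // mulmxA f3 // mulmxA.
Qed.

Lemma chain_map_le N' N A B f : (N' <= N)%N -> chain_map N A B f -> chain_map N' A B f.
Proof.
move=> le [h1 h2 h3]; split=> // i h; [apply: h1 | apply: h3];
  exact: leq_trans le.
Qed.

Lemma homog_mx_lift a b c (gA : 'I_a -> int) (gB : 'I_b -> int) (gC : 'I_c -> int)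
    (D : 'M[P]_(b, c)) (X : 'M[P]_(a, c)) : homog_mx gB gC D -> homog_mx gA gC X ->
  (forall i, exists w, row i X = w *m D) ->
  exists2 Y, homog_mx gA gB Y & Y *m D = X.
Proof.
move=> hD hX h.
have /choice[w hw] i : exists w, homog_row gB (gA i) w /\ row i X = w *m D.
  have [|w h1 h2] := homog_row_lift (e := gA i) hD _ (h i); last by exists w.
  by move=> ? j; rewrite mxE; apply: hX.
exists (\matrix_i w i) => [i j|].
  by rewrite mxE; apply: (hw i).1.
by apply/row_matrixP => i; rewrite row_mul rowK (hw i).2.
Qed.

(** The comparison theorem for the identity of P / P_+: each map is lifted row by row through the
    exactness of [B]. *)
Lemma chain_lift N A B : exact_upto N A -> exact_upto N B -> exists f, chain_map N A B f.
Proof.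
move=> hA hB; have [ontoB exB exB'] := hB.
have [f0 hf0 f0a] : exists2 f0, homog_mx (cbd A 0) (cbd B 0) f0 &
    forall a, irrelevant Pd ((f0 *m cau B - cau A) a 0).
  have /choice[w hw] a := ontoB (cau A a 0).
  exists (\matrix_a row_proj (cbd B 0) (cbd A 0 a) (w a)) => [a b|a].
    by rewrite mxE; apply: row_proj_homog.
  have -> : (\matrix_a row_proj (cbd B 0) (cbd A 0 a) (w a) *m cau B) =
     \col_a (row_proj (fun=> 0) (cbd A 0 a) (w a *m cau B)) 0 0.
    apply/row_matrixP => i; rewrite row_mul rowK.
    have hau : homog_mx (cbd B 0) (fun=> 0) (cau B).
      by move=> b j; rewrite subr0 ord1; apply: cau_h.
    by apply/rowP => j; rewrite -(row_projM _ _ hau) !mxE ord1.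
  have := hw a; rewrite !mxE => /(gr_irr hP) h; apply/(gr_irr hP).
  (* Only degree 0 is visible modulo P_+; for a basis element of another degree both values lie in
     P_+. *)
  rewrite subr0; have [e0|ne] := pselect (cbd A 0 a = 0).
    rewrite rprB e0 rpr_id; last exact: rpr_hom.
    by rewrite -rprB -opprB -sub0r rprB h rpr0 subr0.
  have ne' : 0 <> cbd A 0 a by move=> h'; apply: ne.
  rewrite rprB (rpr_ne (rpr_hom _ _) ne') (rpr_ne (cau_h A a) ne') subrr.
  by [].
pose Q i (g : 'M_(crk A i, crk B i)) (g' : 'M_(crk A i.+1, crk B i.+1)) :=
  homog_mx (cbd A i.+1) (cbd B i.+1) g' /\ g' *m cdf B i = cdf A i *m g.
(* Dependent choice of the next map. The default 0 only serves indices where a lift need not exist;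
   [all] shows that it is not taken up to [N]. *)
pose f := nat_rect (fun i => 'M_(crk A i, crk B i)) f0
  (fun i g => if pselect (exists g', Q i g g') is left h then projT1 (cid h) else 0).
have key i : (i < N)%N -> (exists g', Q i (f i) g') -> Q i (f i) (f i.+1).
  by rewrite /=; case: pselect => // h _ _; case: cid.
have all i : (i <= N)%N -> homog_mx (cbd A i) (cbd B i) (f i) /\
    ((i < N)%N -> Q i (f i) (f i.+1)).
  elim: i => [|i IH] lt.
    split=> [//|{}lt]; apply: (key 0%N lt).
    have [|Y h1 h2] := homog_mx_lift (cdf_h B 0%N) (homog_mxM (cdf_h A 0%N) hf0).
      move=> a; apply/(exB lt); rewrite -row_mul mxE.
      have -> : cdf A 0 *m f0 *m cau B =
         cdf A 0 *m (f0 *m cau B - cau A) + cdf A 0 *m cau A.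
        by rewrite mulmxBr subrK mulmxA.
      rewrite mxE.
      apply: irrelevantD; last exact: exact_da hA lt _.
      by rewrite mxE; apply: irrelevant_sum => b _; apply: irrelevantM.
    by exists Y.
  have [hf hQ] := IH (ltnW lt); have {hQ}[h1 h2] := hQ lt.
  split=> // lt'; apply: key => //.
  have [|Y h3 h4] := homog_mx_lift (cdf_h B i.+1) (homog_mxM (cdf_h A i.+1) h1).
    move=> a; apply/(exB' _ lt'); rewrite -row_mul -mulmxA h2 mulmxA (exact_dd hA lt').
    by rewrite mul0mx row0.
  by exists Y.
exists f; split=> // [i /all[]//|i lt].
by have [_ /(_ lt)[]] := all i (ltnW lt).
Qed.

(** With all generators of the i-th term in degree i, minimality says that no nonzero row with
    entries in P_0 is killed by the differential, or by the augmentation modulo P_+. *)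
Definition linear_upto N (C : cplx) : Prop :=
  [/\ forall i b, cbd C i b = i%:Z,
   forall w : 'rV_(crk C 0), (forall b, Pd 0 (w 0 b)) ->
     irrelevant Pd ((w *m cau C) 0 0) -> w = 0 &
   forall i, (i < N)%N -> forall w : 'rV_(crk C i.+1), (forall b, Pd 0 (w 0 b)) ->
     w *m cdf C i = 0 -> w = 0].

Lemma homog_mx1 b (g : 'I_b -> int) : homog_mx g g 1%:M.
Proof.
move=> i j; rewrite mxE; case: eqP => [->|_]; last exact: rhom0.
by rewrite subrr; apply: gr_hom1 hP.
Qed.

(* Minimality makes homotopies unnecessary: the identity is the only
   homogeneous lift of the identity of the residue field. *)
Lemma linear_endo N C f : linear_upto N C -> chain_map N C C f ->
  forall i, (i <= N)%N -> f i = 1%:M.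
Proof.
move=> [hb h0 hi] [f1 f2 f3].
have deg0 i a : (i <= N)%N -> forall b, Pd 0 (row a (f i - 1%:M) 0 b).
  move=> le b; rewrite !mxE; have := f1 i le a b; rewrite !hb subrr => h.
  by apply: rhomB => //; have := homog_mx1 (cbd C i) a b; rewrite !hb subrr mxE.
elim=> [|i IH] le; apply/eqP; rewrite -subr_eq0; apply/eqP; apply/row_matrixP => a;
  rewrite row0.
  apply: h0; first exact: deg0.
  by rewrite -row_mul mulmxBl mul1mx mxE.
apply: hi (le) _ _ _; first exact: deg0.
by rewrite -row_mul mulmxBl mul1mx f3 // IH ?(ltnW le) // mulmx1 subrr row0.
Qed.

(** * Vanishing of Tor and change of resolution *)

Section Homology.
Variables (V : lmodType P).

Definition mx_act a b (M : 'M[P]_(a, b)) (v : 'I_a -> V) : 'I_b -> V :=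
  fun c => \sum_i M i c *: v i.

Lemma mx_actM a b c (M : 'M[P]_(a, b)) (M' : 'M[P]_(b, c)) v :
  mx_act (M *m M') v = mx_act M' (mx_act M v).
Proof.
apply: funext => k; rewrite /mx_act.
under eq_bigr => i _ do rewrite mxE scaler_suml.
rewrite exchange_big; apply: eq_bigr => j _; rewrite scaler_sumr.
by apply: eq_bigr => i _; rewrite scalerA mulrC.
Qed.

Lemma mx_act0 a b (M : 'M[P]_(a, b)) v : (forall i, v i = 0) -> forall c, mx_act M v c = 0.
Proof. by move=> h c; rewrite /mx_act big1 // => i _; rewrite h scaler0. Qed.

Lemma mx_act1 a v : mx_act (1%:M : 'M[P]_a) v = v.
Proof.
apply: funext => c; rewrite /mx_act (bigD1 c) //= mxE eqxx scale1r big1 ?addr0 //.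
by move=> i /negPf ic; rewrite mxE ic scale0r.
Qed.

Lemma mx_actB a b (M : 'M[P]_(a, b)) v w c :
  mx_act M (fun i => v i - w i) c = mx_act M v c - mx_act M w c.
Proof. by rewrite /mx_act -sumrB; apply: eq_bigr => i _; rewrite scalerBr. Qed.

Definition homog_vec (N : int -> set V) a (g : 'I_a -> int) j (v : 'I_a -> V) :=
  forall i, N (j - g i) (v i).

Definition is_cycle C i : ('I_(crk C i) -> V) -> Prop :=
  match i with
  | 0%N => fun=> True
  | i'.+1 => fun v => forall b, mx_act (cdf C i') v b = 0
  end.

Definition tor_vanish C (N : int -> set V) i j := forall v : 'I_(crk C i) -> V,
  homog_vec N (cbd C i) j v -> is_cycle v ->
  exists2 w, homog_vec N (cbd C i.+1) j w & v = mx_act (cdf C i) w.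

Lemma tor_cycleE F N i j (v : 'I_(rk F i) -> V) :
  tor_cycle N j v <-> homog_vec N (cbd (of_res F) i) j v /\ is_cycle (C := of_res F) v.
Proof. by case: i v => [|i] v /=; split=> // -[]. Qed.

(** An empty basis of homology means that all cycles bound. The resolution stays existential and may
    vary with [i] and [j]. *)
Lemma betti0 N i j : betti Pd N i j 0 <-> exists F, tor_vanish (of_res F) N i j.
Proof.
split=> [[F [z [_ hz _]]]|[F hF]]; exists F.
  move=> v hv cv; have [|c [_]] := hz v; first exact/tor_cycleE.
  by case=> w hw e; exists w => //; apply: (etrans _ e); apply: funext => a; rewrite big_ord0 subr0.
exists (fun=> fun=> 0); split=> [[]//|v /tor_cycleE[hv cv]|c _ _ []//].
exists (fun=> 0); split=> [[]//|].
have [w hw e] := hF v hv cv.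
exists w => //; apply: (etrans _ e); apply: funext => a.
by rewrite big_ord0 subr0.
Qed.

Record graded_family (N : int -> set V) : Prop := {
  gf0 : forall e, N e 0;
  gfD : forall e x y, N e x -> N e y -> N e (x + y);
  gfZ : forall e f p x, Pd e p -> N f x -> N (e + f) (p *: x)
}.

Lemma gf_sum N e I (r : seq I) (Q : pred I) (E : I -> V) : graded_family N ->
  (forall i, Q i -> N e (E i)) -> N e (\sum_(i <- r | Q i) E i).
Proof.
move=> hN h; elim/big_ind: _ => //; [exact: gf0 hN _ | exact: gfD hN _].
Qed.

Lemma mx_act_homog N a b (gA : 'I_a -> int) (gB : 'I_b -> int) M j v : graded_family N ->
  homog_mx gA gB M -> homog_vec N gA j v -> homog_vec N gB j (mx_act M v).
Proof.
move=> hN hM hv c; apply: gf_sum => // i _.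
have -> : j - gB c = (gA i - gB c) + (j - gA i) by lia.
exact: gfZ hN _ _ _ _ (hM i c) (hv i).
Qed.

Lemma chain_map_cycle K C D f i v : (i <= K)%N -> chain_map K C D f -> is_cycle (C := C)
  (i := i) v ->
  is_cycle (C := D) (mx_act (f i) v).
Proof.
case: i v => [//|i] v le [_ _ h] cv b.
by rewrite -mx_actM (h i le) mx_actM; apply: mx_act0.
Qed.

(** A cycle of [C] is sent to [D], bounds there, and the bounding vector is sent back; this needs
    [psi] one place further than [phi]. *)
Lemma tor_vanish_retract N C D i j phi psi : graded_family N ->
  chain_map i C D phi -> chain_map i.+1 D C psi -> phi i *m psi i = 1%:M ->
  tor_vanish D N i j -> tor_vanish C N i j.
Proof.
move=> hN hphi hpsi e hD v hv cv; have [hphi1 _ _] := hphi; have [psi1 _ psi3] := hpsi.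
have [||w hw ew] := hD (mx_act (phi i) v).
- by apply: mx_act_homog hv => //; apply: hphi1.
- exact: chain_map_cycle hphi cv.
exists (mx_act (psi i.+1) w); first by apply: mx_act_homog hw => //; apply: psi1.
by rewrite -mx_actM psi3 // mx_actM -ew -mx_actM e mx_act1.
Qed.

(** Exchanges the resolution that witnesses a Betti number for one fixed linear resolution: the
    round trip C -> D -> C is the identity by [linear_endo]. *)
Lemma tor_vanish_linear N C D i j : graded_family N ->
  (forall K, exact_upto K C) -> (forall K, linear_upto K C) ->
  (forall K, exact_upto K D) -> tor_vanish D N i j -> tor_vanish C N i j.
Proof.
move=> hN eC lC eD hD.
have [phi hphi] := chain_lift (eC i) (eD i).
have [psi hpsi] := chain_lift (eD i.+1) (eC i.+1).
apply: (tor_vanish_retract hN hphi hpsi) => //.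
exact: (linear_endo (lC i) (chain_map_comp hphi (chain_map_le (leqnSn i) hpsi)) (leqnn i)).
Qed.

End Homology.
End GradedRing.

Arguments cbd {P Pd} c i _.
Arguments cau_h {P Pd} c b.
Arguments cdf_h {P Pd} c i.
Arguments chain_map {P Pd} N A B f.

(** * The linear resolution of the residue field *)

Section Components.
Variables (P : comPzRingType) (Pd : int -> set P) (pr : int -> P -> P).
Hypothesis hP : graded_ring Pd pr.
Variables (V : lmodType P) (G : int -> set V) (pv : int -> V -> V).
Hypothesis hG : graded_module Pd G pr pv.

Lemma pr_comp e f p x : G f x -> pv e (p *: x) = pr (e - f) p *: x.
Proof. by move=> Gx; rewrite -(prZr hG _ _ Gx) subrK. Qed.

Lemma component_family t : graded_family Pd (component G t).
Proof.
have hS := smul_setT_submodule (G t); split=> [e|e x y [? ?] [? ?]|e f p x hp [? ?]].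
- by split; [exact: hom0 hG _ | exact: submodule0].
- by split; [exact: homD hG _ _ _ _ _ | exact: submoduleD].
- by split; [exact: homZ hG _ _ _ _ hp _ | exact: submoduleZ].
Qed.

Lemma component_low t s x : (s < t)%R -> component G t s x -> x = 0.
Proof.
move=> st [Gx [r [hr e]]]; rewrite -(pr_id hG Gx) e (prs hG) big_seq big1 // => p.
by move=> /hr[_ Gp]; rewrite (pr_comp s p.1 Gp) (rpr_neg hP) ?scale0r // subr_lt0.
Qed.

Lemma residue_dichotomy p : pr 0 p = 0 \/ exists q, pr 0 (q * p - 1) = 0.
Proof.
have [|[q hq e]] := gr_field hP (rpr_hom hP 0 p); [by left | right; exists q].
rewrite (rprB hP) (rpr_id hP (gr_hom1 hP)) -{1}[0 : int]addr0 (rprM hP _ _ hq) e.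
exact: subrr.
Qed.

(** The base for linear algebra in degree [d]: modulo [above d] the irrelevant ideal kills [G d],
    whose elements then behave as vectors over the residue field. *)
Definition above d : set V := [set z | forall e, (e <= d)%R -> pv e z = 0].

Lemma above_submodule d : submodule (above d).
Proof.
split=> [e _|x y hx hy e le|a x hx e le]; first exact: pr0 hG _.
  by rewrite (prD hG) hx ?hy ?addr0.
have [k hk] := pr_sum hG x; rewrite [x](hk k) // scaler_sumr (prs hG) big1 // => i _.
have [id|di] := leP i%:Z d; first by rewrite hx // scaler0 (pr0 hG).
rewrite (pr_comp _ _ (pr_hom hG _ _)) (rpr_neg hP) ?scale0r //; lia.
Qed.

Lemma above_irr d p x : pr 0 p = 0 -> G d x -> above d (p *: x).
Proof.
move=> p0 Gx e le; rewrite (pr_comp _ _ Gx).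
have [->|ne] := eqVneq e d; first by rewrite subrr p0 scale0r.
by rewrite (rpr_neg hP) ?scale0r // subr_lt0 lt_neqAle ne.
Qed.

Lemma mx_act_row a b (M : 'M[P]_(a, b)) (y : 'rV[P]_a) (x : V) :
  mx_act M (fun i => y 0 i *: x) = fun c => (y *m M) 0 c *: x.
Proof.
apply: funext => c; rewrite /mx_act mxE scaler_suml; apply: eq_bigr => i _.
by rewrite scalerA mulrC.
Qed.

(** * Kernels in a linear resolution are generated by linear forms *)

Section Kernel.
Variables (d : int) (x : V).
Hypotheses (Gx : G d x) (x0 : x <> 0) (hgen : G (d + 1) `<=` smul setT (G d)).
Hypothesis H1 : forall (i : nat) j, j <> d + i%:Z ->
  exists F : residue_resolution Pd, tor_vanish (of_res F) (component G d) i j.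
Hypothesis H2 : forall (i : nat) j, j <> d + 1 + i%:Z ->
  exists F : residue_resolution Pd, tor_vanish (of_res F) (component G (d + 1)) i j.

(** This is where the choice of [d] enters, through [hgen]. *)
Lemma component_incl e : component G (d + 1) e `<=` component G d e.
Proof.
move=> v [Gv hv]; split=> //; apply: smul_min hv; first exact: smul_setT_submodule.
by move=> a u _ /hgen; apply: submoduleZ; apply: smul_setT_submodule.
Qed.

Lemma irr_gen e p : (0 < e)%R -> Pd e p -> smul setT (G (d + 1)) (p *: x).
Proof.
move=> e0 /(gr_std hP e0).
apply: (@smul_min _ P^o setT _ [set q | smul setT (G (d + 1)) (q *: x)]).
  have hS := smul_setT_submodule (G (d + 1)); split=> [|q r|a q] /=.
  - by rewrite scale0r; apply: submodule0.
  - by rewrite scalerDl; apply: submoduleD.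
  - by rewrite -[a *: q]/(a * q) -scalerA; apply: submoduleZ.
move=> a q _ Pq /=; rewrite -[a *: q]/(a * q) -scalerA; apply: smul_mem => //.
by rewrite addrC; apply: homZ hG _ _ _ _ Pq Gx.
Qed.

(* A cocycle [z] of the partial linear resolution [C] maps to a boundary [y d] in
   resolutions [F2] and then [F1] given by [H2] and [H1].  Tensoring with
   [x] in [G d] and using [H2] then [H1] shows that [y], up to boundaries, has
   irrelevant coefficients; projecting back to [C] gives [z] as a combination of
   kernel elements of smaller degree. *)
Lemma ker_generated (C : cplx Pd) i (e : nat) (z : 'rV_(crk C i.+1)) :
  exact_upto i.+1 C -> linear_upto i.+1 C ->
  (forall b, Pd e%:Z (z 0 b)) -> z *m cdf C i = 0 ->
  smul setT [set u : 'rV_(crk C i.+1) | u *m cdf C i = 0 /\ forall b, Pd 1 (u 0 b)] z.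
Proof.
move=> eC lC; set Z1 := (X in smul _ X); have [lb _ lind] := lC.
have hS := smul_setT_submodule Z1.
elim/ltn_ind: e z => -[|[|e0]] IH z hz zD.
- by rewrite (lind i (ltnSn i) z hz zD); apply: submodule0.
- exact: smul_setT_mem.
(* [z] has internal degree J = (i + 1) + e. The degree left open by [H2] at place i + 1 and the one
   left open by [H1] at place i + 2 both correspond to e = 1, while here e >= 2. *)
set e := e0.+2 in IH hz; set J : int := i.+1%:Z + e%:Z.
have [F2 hF2] : exists F : residue_resolution Pd, tor_vanish (of_res F) (component G (d +
  1)) i.+1 (J + d).
  by apply: H2; rewrite /J /e; lia.
have [F1 hF1] : exists F : residue_resolution Pd, tor_vanish (of_res F) (component G d)
  i.+2 (J + d).
  by apply: H1; rewrite /J /e; lia.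
set A2 := of_res F2 in hF2; set A1 := of_res F1 in hF1.
have eA1 N : exact_upto N A1 by apply: of_res_exact.
have eA2 N : exact_upto N A2 by apply: of_res_exact.
have [phi hphi] := chain_lift hP eC (eA2 i.+1).
have [rho hrho] := chain_lift hP (eA2 i.+2) (eA1 i.+2).
have [psi hpsi] := chain_lift hP (eA1 i.+1) eC.
have [phi1 _ phi3] := hphi; have [rho1 _ rho3] := hrho; have [psi1 _ psi3] := hpsi.
have hzr : homog_row Pd (cbd C i.+1) J z.
  by move=> a b; rewrite ord1 lb /J addrC addKr.
have [_ _ exA2] := eA2 i.+3.
have [_ _ exA1] := eA1 i.+4.
have [y hy ey] : exists2 y, homog_row Pd (cbd A2 i.+2) J y & z *m phi i.+1 = y *m cdf A2 i.+1.
  apply: (homog_row_lift hP (cdf_h A2 i.+1)); first exact: (homog_mxM hP hzr (phi1 _ (leqnn _))).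
  by apply/exA2 => //; rewrite -mulmxA phi3 // mulmxA zD mul0mx.
have hN := component_family d.
pose v b := y 0 b *: x.
have hv : homog_vec (component G d) (cbd A2 i.+2) (J + d) v.
  move=> b; have := hy 0 b => hyb; split.
    by rewrite addrAC; apply: homZ hG _ _ _ _ hyb Gx.
  exact: smul_mem.
(* This is the connecting homomorphism: [v] has values in G_<d>, while its boundary [u] is the image
   of [z] tensored with [x], has coefficients in P_+, and so takes values in G_<d+1>. *)
pose u := mx_act (cdf A2 i.+1) v.
have uE c : u c = (z *m phi i.+1) 0 c *: x by rewrite /u mx_act_row ey.
have [|b|w' hw' ew'] := hF2 u.
- move=> c; split.
    by have [] := mx_act_homog hN (cdf_h A2 i.+1) hv c.
  rewrite uE mxE scaler_suml; apply: submodule_sum; first exact: smul_setT_submodule.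
  move=> a _; rewrite mulrC -scalerA; apply: submoduleZ; first exact: smul_setT_submodule.
  by apply: irr_gen (hz a).
- have -> : u = fun c => (z *m phi i.+1) 0 c *: x by apply: funext.
  by rewrite mx_act_row -mulmxA phi3 // mulmxA zD mul0mx mxE scale0r.
pose v' b := v b - w' b.
have hv' : homog_vec (component G d) (cbd A2 i.+2) (J + d) v'.
  move=> b; have [? ?] := hv b; have [? ?] := component_incl (hw' b).
  by split; [exact: homB hG _ _ _ _ _ | apply: submoduleB => //; apply: smul_setT_submodule].
have [||w hw ew] := hF1 (mx_act (rho i.+2) v').
- by apply: (mx_act_homog hN) hv'; apply: rho1.
- apply: (chain_map_cycle (leqnn i.+2) hrho) => b /=.
  by rewrite mx_actB -/u ew' subrr.
pose Y := y *m rho i.+2.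
have hY : homog_row Pd (cbd A1 i.+2) J Y by apply: (homog_mxM hP hy (rho1 _ (leqnn _))).
(* At a basis element of degree J all values have degree d, where the contribution of [w'] vanishes
   because G_<d+1> starts in degree d + 1. *)
have Yx a : cbd A1 i.+2 a = J -> Y 0 a *: x = mx_act (cdf A1 i.+2) w a.
  move=> ea; have := congr1 (fun f => f a) ew; rewrite /v' mx_actB mx_act_row -/Y => <-.
  rewrite (component_low (t := d + 1) (s := d) (x := mx_act (rho i.+2) w' a)) ?subr0 //.
    lia.
  have := mx_act_homog (component_family (d + 1)) (rho1 _ (leqnn _)) hw' a.
  by rewrite ea addrAC subrr add0r.
(* A linear form with value 1 at [x], evaluated on the degree d values of [w], turns the vector
   identity [Yx] into an identity of scalars; [q] collects its values. *)
pose T := [seq w c | c <- enum 'I_(crk A1 i.+3) & cbd A1 i.+3 c == J].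
have [|q p|xA|A' [hA' AA' nx hT]] := @hyperplane _ _ [set p | pr 0 p = 0]
  residue_dichotomy (above d) x T.
- exact: above_submodule.
- rewrite inE => /orP[/eqP->|/mapP[c]]; first by move=> p0; apply: above_irr.
  rewrite mem_filter => /andP[/eqP ec _] -> p0; apply: above_irr => //.
  by have [] := hw c; rewrite ec addrAC subrr add0r.
- by apply: x0; rewrite -(pr_id hG Gx); apply: xA.
have /choice[q hq] c : exists q, cbd A1 i.+3 c = J -> A' (w c - q *: x).
  have [ec|nc] := pselect (cbd A1 i.+3 c = J); last by exists 0.
  have [|q hq] := hT (w c); last by exists q.
  by apply: map_f; rewrite mem_filter ec eqxx mem_enum.
pose y' : 'rV_(crk A1 i.+3) := \row_c if cbd A1 i.+3 c == J then pr 0 (q c) else 0.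
(* Subtracting a boundary leaves the image in [C] unchanged and, by the linear form, removes all
   entries of degree 0. *)
pose Y2 := Y - y' *m cdf A1 i.+2.
have hy' : homog_row Pd (cbd A1 i.+3) J y'.
  move=> a c; rewrite mxE; case: eqP => [->|_]; last exact: (rhom0 hP).
  by rewrite subrr; apply: (rpr_hom hP).
have hY2 : homog_row Pd (cbd A1 i.+2) J Y2.
  move=> a c; rewrite ord1 [Y2 _ _]mxE [(- _ : 'M_(_,_)) _ _]mxE; apply: (rhomB hP).
    exact: hY.
  exact: (homog_mxM hP hy' (cdf_h A1 i.+2)).
have Y2J a : cbd A1 i.+2 a = J -> Y2 0 a = 0.
  move=> ea; have h0 := hY2 0 a; rewrite ea subrr in h0.
  rewrite -(rpr_id hP h0); have [//|[r hr]] := residue_dichotomy (Y2 0 a).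
  have hA : A' (Y2 0 a *: x).
    have -> : Y2 0 a *: x = \sum_c cdf A1 i.+2 c a *: (w c - y' 0 c *: x).
      rewrite [Y2 _ _]mxE [(- _ : 'M_(_,_)) _ _]mxE scalerBl Yx // [in X in _ - X]mxE scaler_suml.
      rewrite /mx_act -sumrB; apply: eq_bigr => c _.
      by rewrite scalerBr !scalerA mulrC.
    apply: submodule_sum => // c _; rewrite mxE; case: eqP => [ec|/eqP nc].
      apply: submoduleZ => //.
      have -> : w c - pr 0 (q c) *: x = (w c - q c *: x) + (q c - pr 0 (q c)) *: x.
        by rewrite scalerBl addrA subrK.
      apply: submoduleD => //; first exact: hq.
      apply: AA'; apply: above_irr => //.
      by rewrite (rprB hP) (rpr_id hP (rpr_hom hP _ _)) subrr.
    rewrite scale0r subr0.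
    (* Only basis elements of degree J contribute: below J the matrix entry has negative degree,
       above J the value [w c] would have degree less than d. *)
    have [lt|gt|e'] := ltgtP (cbd A1 i.+3 c) J; last by rewrite e' eqxx in nc.
      rewrite (rhom_neg hP _ (cdf_h A1 i.+2 c a)) ?scale0r ?ea ?subr_lt0 //.
      exact: submodule0.
    rewrite (component_low _ (hw c)) ?scaler0; first exact: submodule0.
    lia.
  exfalso; apply: nx.
  have -> : x = r *: (Y2 0 a *: x) - (r * Y2 0 a - 1) *: x.
    by rewrite scalerBl scale1r scalerA opprB addrC subrK.
  apply: submoduleB => //; first exact: submoduleZ.
  by apply: AA'; apply: above_irr.
(* The rows of [W] are homogeneous kernel elements. In [z = Y2 *m W] the coefficients survive only
   at basis elements of degree below J, that is on rows covered by the induction on [e]. *)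
pose W := cdf A1 i.+1 *m psi i.+1.
have WD : W *m cdf C i = 0.
  by rewrite /W -mulmxA psi3 // mulmxA (exact_dd (eA1 i.+2)) ?mul0mx.
have hW : homog_mx Pd (cbd A1 i.+2) (cbd C i.+1) W.
  exact: (homog_mxM hP (cdf_h A1 i.+1) (psi1 _ (leqnn _))).
have zE : z = Y2 *m W.
  have := linear_endo hP lC (chain_map_comp hP hphi (chain_map_comp hP (chain_map_le
    (leqnSn _) hrho) hpsi)) (leqnn i.+1).
  move=> e1; rewrite -[LHS]mulmx1 -e1 !mulmxA ey -[y *m _ *m _]mulmxA -rho3 // mulmxA -/Y.
  congr (_ *m _); rewrite mulmxBl -[y' *m _ *m _]mulmxA.
  by rewrite (exact_dd (eA1 i.+3)) // mulmx0 subr0.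
rewrite zE mulmx_sum_row; apply: submodule_sum => // a _.
have [lt|gt|ea] := ltgtP (cbd A1 i.+2 a) J; last by rewrite Y2J // scale0r; apply: submodule0.
  apply: submoduleZ => //.
  have rD : row a W *m cdf C i = 0 by rewrite -row_mul WD row0.
  have rh b : Pd (cbd A1 i.+2 a - i.+1%:Z) (row a W 0 b).
    by rewrite mxE -(lb i.+1 b); apply: hW.
  have [neg|pos] := ltP (cbd A1 i.+2 a - i.+1%:Z) 0.
    have -> : row a W = 0.
      by apply/rowP => b; rewrite [RHS]mxE; apply: (rhom_neg hP neg).
    exact: submodule0.
  case E: (cbd A1 i.+2 a - i.+1%:Z) pos rh => [e'|//] _ rh.
  by apply: (IH e') => //; move: lt E; rewrite /J; lia.
rewrite (rhom_neg hP _ (hY2 0 a)) ?scale0r; first exact: submodule0.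
by rewrite subr_lt0.
Qed.

End Kernel.
End Components.

(** * Construction of the linear resolution *)

Section LinearResolution.
Variables (P : comPzRingType) (Pd : int -> set P) (pr : int -> P -> P).
Hypothesis hP : graded_ring Pd pr.

Definition deg0_free m b (D : 'M[P]_(m, b)) :=
  forall w : 'rV_m, (forall a, Pd 0 (w 0 a)) -> w *m D = 0 -> w = 0.

(** Take the least number of rows spanning the linear forms of [Z] over P_0. A nontrivial relation
    over P_0 has an invertible coefficient, so one row could be dropped. *)
Lemma minimal_generators b (Z : set 'rV[P]_b) : submodule Z ->
  (forall z, Z z -> smul setT [set u | Z u /\ forall c, Pd 1 (u 0 c)] z) ->
  exists m (D : 'M[P]_(m, b)), [/\ forall a c, Pd 1 (D a c),
    forall u, Z u <-> exists w, u = w *m D & deg0_free D].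
Proof.
move=> hZ hgen.
pose Q m := `[< exists D : 'M[P]_(m, b), [/\ forall a c, Pd 1 (D a c), forall a, Z (row a D) &
      forall z, Z z -> (forall c, Pd 1 (z 0 c)) ->
        exists2 w : 'rV[P]_m, forall a, Pd 0 (w 0 a) & z = w *m D] >].
have exQ : exists m, Q m.
  by have [m [D h]] := gr_fg hP hZ; exists m; apply/asboolP; exists D.
case: (ex_minnP exQ) => m /asboolP[D [hD ZD hDz]] min; exists m, D; split=> //.
  move=> u; split=> [/hgen|[w ->]].
    apply: (@smul_min _ _ _ _ [set u | exists w, u = w *m D]).
      split=> [|_ _ [w ->] [w' ->]|a _ [w ->]].
      - by exists 0; rewrite mul0mx.
      - by exists (w + w'); rewrite mulmxDl.
      - by exists (a *: w); rewrite scalemxAl.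
    move=> a v _ [Zv hv]; have [w _ ->] := hDz v Zv hv.
    by exists (a *: w); rewrite scalemxAl.
  by rewrite mulmx_sum_row; apply: submodule_sum => // a _; apply: submoduleZ.
move=> w hw wD; apply/rowP => a; rewrite mxE.
have [//|[q hq qw]] := gr_field hP (hw a).
case: m D w a {exQ} min hD ZD hDz hw wD q hq qw => [|m] D w a min hD ZD hDz hw wD q hq qw.
  by case: a {qw}.
have : (m.+1 <= m)%N; last by rewrite ltnn.
apply: min; apply/asboolP.
have rowa : row a D = \sum_i (- (q * w 0 (lift a i))) *: row (lift a i) D.
  have : q *: (w *m D) = 0 by rewrite wD scaler0.
  rewrite mulmx_sum_row (bigD1_ord a) //= scalerDr scalerA qw scale1r => /eqP.
  rewrite addr_eq0 => /eqP ->; rewrite scaler_sumr -sumrN; apply: eq_bigr => i _.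
  by rewrite scalerA scaleNr.
exists (\matrix_i row (lift a i) D); split=> [i c|i|z Zz hz].
- by rewrite !mxE.
- by rewrite rowK.
have [v hv ->] := hDz z Zz hz.
exists (\row_i (v 0 (lift a i) - v 0 a * (q * w 0 (lift a i)))).
  move=> i; rewrite mxE; apply: (rhomB hP) => //.
  rewrite -[0 : int]addr0; apply: (rhomM hP) => //.
  by rewrite -[0 : int]addr0; apply: (rhomM hP).
rewrite !mulmx_sum_row (bigD1_ord a) //= rowa scaler_sumr -big_split.
apply: eq_bigr => i _ /=; rewrite rowK mxE scalerA -scalerDl mulrN addrC.
by [].
Qed.

Lemma row_pr_sum b (z : 'rV[P]_b) : exists k,
  z = \sum_(e < k) \row_c pr e%:Z (z 0 c).
Proof.
have /choice[k hk] c : exists k, forall k', (k <= k')%N ->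
    z 0 c = \sum_(e < k') pr e%:Z (z 0 c) by apply: (pr_sum (gr_mod hP)).
exists (\max_c k c)%N; apply/rowP => c; rewrite summxE [LHS](hk c (\max_c k c)%N).
  by apply: eq_bigr => e _; rewrite mxE.
exact: leq_bigmax.
Qed.

Lemma irrelevant_generated (z : 'rV[P]_1) : irrelevant Pd (z 0 0) ->
  smul setT [set u : 'rV[P]_1 | irrelevant Pd (u 0 0) /\ forall c, Pd 1 (u 0 c)] z.
Proof.
set Z1 := (X in smul _ X) => hz; have hS := smul_setT_submodule Z1.
have [k ->] := row_pr_sum z; apply: submodule_sum => // e _.
case: e => [[|e] ek] /=.
  have -> : (\row_c pr 0 (z 0 c)) = 0; last exact: submodule0.
  by apply/rowP => c; rewrite !mxE ord1; apply/(gr_irr hP).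
pose row1 (p : P) : 'rV[P]_1 := \row__ p.
rewrite (_ : \row_c _ = row1 (pr e.+1%:Z (z 0 0))); last first.
  by apply/rowP => c; rewrite !mxE ord1.
have := gr_std hP _ (rpr_hom hP e.+1%:Z (z 0 0)).
move=> /(_ isT); apply: (@smul_min _ P^o setT _ [set q | smul setT Z1 (row1 q)]).
  split=> [|p q /= hp hq|a q /= hq].
  - rewrite /= (_ : row1 0 = 0); first exact: submodule0.
    by apply/rowP => c; rewrite !mxE.
  - rewrite (_ : row1 (p + q) = row1 p + row1 q); first exact: submoduleD.
    by apply/rowP => c; rewrite !mxE.
  - rewrite (_ : row1 (a *: q) = a *: row1 q); first exact: submoduleZ.
    by apply/rowP => c; rewrite !mxE.
move=> a q _ h /=; rewrite (_ : row1 (a *: q) = a *: row1 q); last first.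
  by apply/rowP => c; rewrite !mxE.
apply: submoduleZ => //; apply: smul_setT_mem; split=> [|c]; rewrite mxE //.
by apply/(gr_irr hP); apply: (rpr_ne hP h).
Qed.

Record stage := Stage {
  s_src : nat; s_tgt : nat; s_mx : 'M[P]_(s_src, s_tgt);
  s_lin : forall a b, Pd 1 (s_mx a b)
}.

Definition next_mx (x : stage) := {m & {D : 'M[P]_(m, s_src x) | forall a b, Pd 1 (D a b)}}.

Definition good_next (x : stage) (y : next_mx x) :=
  (forall u : 'rV_(s_src x), u *m s_mx x = 0 <-> exists w, u = w *m sval (projT2 y)) /\
  deg0_free (sval (projT2 y)).

Lemma next_mx0_subproof (x : stage) (a : 'I_0) b : Pd 1 ((0 : 'M[P]_(0, s_src x)) a b).
Proof. by case: a. Qed.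

(** Total, with an empty matrix as default: that a good successor exists depends on exactness and
    minimality of all earlier stages, known only in the induction of [lin_cplxP]. *)
Definition choose_next (x : stage) : next_mx x :=
  if pselect (exists y, @good_next x y) is left h then projT1 (cid h)
  else existT _ 0%N (exist _ 0 (@next_mx0_subproof x)).

Lemma choose_nextP (x : stage) : (exists y, @good_next x y) -> good_next (choose_next x).
Proof. by move=> h; rewrite /choose_next; case: pselect => // h'; case: cid. Qed.

Definition next_stage (x : stage) : stage := Stage (svalP (projT2 (choose_next x))).

Section Build.
Variables (m0 : nat) (D0 : 'M[P]_(m0, 1)) (hD0 : forall a b, Pd 1 (D0 a b)).
Hypothesis D0_irr : forall u : 'rV[P]_1,
  irrelevant Pd (u 0 0) <-> exists w, u = w *m D0.
Hypothesis D0_indep : deg0_free D0.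

Definition stages i := iter i next_stage (Stage hD0).

Lemma lin_au_h (b : 'I_1) : Pd 0%:Z ((1%:M : 'cV[P]_1) b 0).
Proof. by rewrite mxE !ord1 eqxx; apply: gr_hom1 hP. Qed.

Lemma lin_df_h i : homog_mx Pd (fun=> i.+1%:Z) (fun=> i%:Z) (s_mx (stages i)).
Proof.
move=> a b; have -> : i.+1%:Z - i%:Z = 1 by lia.
exact: s_lin.
Qed.

Definition lin_cplx : cplx Pd :=
  @Cplx P Pd (fun i => s_tgt (stages i)) (fun i _ => i%:Z) 1%:M
    (fun i => s_mx (stages i)) lin_au_h lin_df_h.

(** Exactness and linearity have to be proved together: both up to N + 1 are what makes the next
    kernel generated by linear forms, and [minimal_generators] then yields both properties of the
    new differential. *)
Lemma lin_cplxP :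
  (forall N, exact_upto N.+1 lin_cplx -> linear_upto N.+1 lin_cplx ->
    forall z : 'rV_(crk lin_cplx N.+1), z *m cdf lin_cplx N = 0 ->
    smul setT [set u : 'rV_(crk lin_cplx N.+1) | u *m cdf lin_cplx N = 0 /\ forall b, Pd
      1 (u 0 b)] z) ->
  forall N, exact_upto N lin_cplx /\ linear_upto N lin_cplx.
Proof.
move=> hker; have onto (p : P) : exists u : 'rV_1,
    irrelevant Pd (p - (u *m (1%:M : 'cV[P]_1)) 0 0).
  exists (\row__ p); rewrite mulmx1 mxE subrr; apply/(gr_irr hP); exact: (rpr0 hP).
have lin0 (w : 'rV[P]_1) : (forall b, Pd 0 (w 0 b)) ->
    irrelevant Pd ((w *m (1%:M : 'cV[P]_1)) 0 0) -> w = 0.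
  move=> hw; rewrite mulmx1 => h; apply/rowP => b; rewrite mxE ord1.
  exact: (irrelevant0 hP).
elim=> [|[|N] [IHe IHl]]; first by split; split.
  split; split=> //.
    move=> _ u; rewrite mulmx1; exact: D0_irr.
  by case=> // _ w; apply: D0_indep.
have Zsub : submodule [set z : 'rV_(crk lin_cplx N.+1) | z *m cdf lin_cplx N = 0].
  split=> [|x y /= hx hy|a x /= hx]; first by rewrite /= mul0mx.
    by rewrite mulmxDl hx hy addr0.
  by rewrite -scalemxAl hx scaler0.
have [|m [D [D1 D2 D3]]] := minimal_generators Zsub; first exact: hker.
have [hex hind] : good_next (choose_next (stages N)).
  by apply: choose_nextP; exists (existT _ m (exist _ D D1)); split.
have [e1 e2 e3] := IHe; have [l1 l2 l3] := IHl.
split; split=> //.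
- move=> k hk; have [ek|] := eqVneq k N; last first.
    by move=> ne; apply: e3; rewrite ltn_neqAle -ltnS hk andbT.
  subst k.
  exact: hex.
- move=> k hk; have [ek|ne] := eqVneq k N.+1; last first.
    by apply: l3; rewrite ltn_neqAle ne -ltnS.
  subst k.
  exact: hind.
Qed.
End Build.

Lemma linear_resolution_exists :
  (forall (C : cplx Pd) i (e : nat) (z : 'rV_(crk C i.+1)),
    exact_upto i.+1 C -> linear_upto i.+1 C ->
    (forall b, Pd e%:Z (z 0 b)) -> z *m cdf C i = 0 ->
    smul setT [set u : 'rV_(crk C i.+1) | u *m cdf C i = 0 /\ forall b, Pd 1 (u 0 b)] z) ->
  exists C : cplx Pd, forall N, exact_upto N C /\ linear_upto N C.
Proof.
move=> hker.
have [||m0 [D0 [h1 h2 h3]]] :=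
    @minimal_generators 1 [set z : 'rV[P]_1 | irrelevant Pd (z 0 0)].
- split=> [|x y hx hy|a x hx] /=; rewrite mxE.
  + by apply/(gr_irr hP); apply: (rpr0 hP).
  + exact: (irrelevantD hP).
  + exact: irrelevantM.
- exact: irrelevant_generated.
exists (lin_cplx h1); apply: lin_cplxP => // N eN lN z hz.
(* [hker] treats homogeneous rows; the components of a kernel row stay in the kernel because the
   differential is homogeneous. *)
have [k ->] := row_pr_sum z; apply: submodule_sum; first exact: smul_setT_submodule.
move=> e _; apply: (hker _ _ e) => // [b|].
  by rewrite mxE; apply: (rpr_hom hP).
have -> : (\row_c pr e (z 0 c)) = row_proj pr (cbd (lin_cplx h1) N.+1) (e%:Z + N.+1%:Z) z.
  by apply/rowP => c; rewrite !mxE addrK.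
rewrite -(row_projM hP _ _ (cdf_h (lin_cplx h1) N)) hz; apply/rowP => c.
by rewrite !mxE (rpr0 hP).
Qed.

(** Kept transparent, so that vanishing of Tor on [of_res (res_of hC)] is convertible to vanishing
    on [C]. *)
Definition res_of (C : cplx Pd) (hC : forall N, exact_upto N C) : residue_resolution Pd.
Proof.
apply: (@ResidueResolution P Pd (crk C) (cbd C) (cau C) (cdf C)).
- exact: cau_h.
- exact: cdf_h.
- by have [] := hC 0%N.
- by have [_ h _] := hC 1%N; apply: h.
- by move=> i; have [_ _ h] := hC i.+2; apply: h.
Defined.

End LinearResolution.

(** * The associated graded ring and modules *)

Section AssociatedGraded.
Variables (R : comNzRingType) (n : set R).
Notation A := (adic n R^o).
Notation P := (gr_ring n).

Section GrModule.
Variables (M : lmodType R) (F : filtration n M).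

Lemma filB j x y : F j x -> F j y -> F j (x - y).
Proof. by move=> hx hy; apply: fil_add => //; apply: fil_opp. Qed.

Lemma monoE i x j : F i x -> mono F i x j = if j == i then x else 0.
Proof. by move=> h; rewrite /mono /= (asboolT h). Qed.

Lemma symbol_eq i x y : F i x -> F i y -> symbol F i x = symbol F i y <-> F i.+1 (x - y).
Proof.
move=> hx hy; rewrite /symbol; split=> [/gr_eqP/(_ i)|h].
  by rewrite !monoE // eqxx.
apply/gr_eqP => j; rewrite !monoE //; case: eqP => [->//|_].
by rewrite subrr; apply: fil_zero.
Qed.

Lemma gr_piB (f g : fseq F) : \pi_(gr F) (f - g) = \pi_(gr F) f - \pi_(gr F) g.
Proof. by apply/eqP; rewrite eq_sym subr_eq -gr_piD subrK. Qed.

Lemma symbolB i x y : F i x -> F i y -> symbol F i (x - y) = symbol F i x - symbol F i y.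
Proof.
move=> hx hy; rewrite /symbol -gr_piB; congr (\pi_(gr F) _); apply: val_inj.
apply: funext => j; rewrite [LHS]monoE; last exact: filB.
rewrite [RHS]/(mono F i x j - mono F i y j) !monoE //.
by case: eqP => _ //; apply: (esym (subrr 0)).
Qed.

Lemma symbol0 i : symbol F i 0 = 0.
Proof. by rewrite -[X in symbol _ _ X](subrr 0) symbolB ?subrr //; apply: fil_zero. Qed.

Lemma symbolD i x y : F i x -> F i y -> symbol F i (x + y) = symbol F i x + symbol F i y.
Proof.
move=> hx hy; rewrite -{1}[y]opprK symbolB //; last exact: fil_opp.
by rewrite -[- y]add0r symbolB ?symbol0 ?sub0r ?opprK //; apply: fil_zero.
Qed.

Lemma symbol_eq0 i x : F i x -> symbol F i x = 0 <-> F i.+1 x.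
Proof.
move=> hx; rewrite -(symbol0 i) symbol_eq // ?subr0 //; exact: fil_zero.
Qed.

Lemma symbol_sum i I (r : seq I) (Q : pred I) (E : I -> M) :
  (forall k, Q k -> F i (E k)) ->
  symbol F i (\sum_(k <- r | Q k) E k) = \sum_(k <- r | Q k) symbol F i (E k).
Proof.
move=> h; elim: r => [|k r IH]; first by rewrite !big_nil symbol0.
rewrite !big_cons; case: ifP => // Qk; rewrite symbolD ?IH //; first exact: h.
exact: fil_sum.
Qed.

Definition gr_proj (e : int) (z : gr F) : gr F :=
  match e with Posz i => symbol F i ((repr z : fseq F) i) | Negz _ => 0 end.

Lemma gr_projE i (f : fseq F) : gr_proj (Posz i) (\pi_(gr F) f) = symbol F i (f i).
Proof.
have [hf _] := fseqP f; have [hr _] := fseqP (repr (\pi_(gr F) f)).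
by apply/symbol_eq => //; apply: (gr_eqP _ _).2; rewrite reprK.
Qed.

Lemma gr_projB e x y : gr_proj e (x - y) = gr_proj e x - gr_proj e y.
Proof.
case: e => [i|i]; last by rewrite /= subr0.
have [f ->] := gr_pi x; have [g ->] := gr_pi y; rewrite -gr_piB !gr_projE.
have [hf _] := fseqP f; have [hg _] := fseqP g.
exact: symbolB.
Qed.

Lemma gr_proj0 e : gr_proj e 0 = 0.
Proof. by have := gr_projB e 0 0; rewrite !subrr. Qed.

Lemma gr_proj_deg e x : gr_deg F e (gr_proj e x).
Proof.
case: e => [i|i] //=; exists ((repr x : fseq F) i) => //.
by have [h _] := fseqP (repr x : fseq F).
Qed.

Lemma gr_proj_id e x : gr_deg F e x -> gr_proj e x = x.
Proof.
case: e => [i [y hy ->]|i /= ->//]; rewrite /symbol gr_projE monoE // eqxx //.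
Qed.

Lemma gr_proj_ne e f x : gr_deg F f x -> e <> f -> gr_proj e x = 0.
Proof.
case: e => [i|i]//; case: f => [j [y hy ->] ne|j x0 _]; last by rewrite (x0 : x = 0) gr_proj0.
rewrite /symbol gr_projE monoE //; case: eqP => [e|_]; last exact: symbol0.
by case: ne; rewrite e.
Qed.

Lemma gr_sep x : (forall i, gr_proj (Posz i) x = 0) -> x = 0.
Proof.
have [f ->] := gr_pi x => h; rewrite -[RHS](symbol0 0).
apply/gr_eqP => j; rewrite monoE; last exact: fil_zero.
rewrite if_same subr0; apply/symbol_eq0; last by rewrite -gr_projE.
by have [hf _] := fseqP f; apply: hf.
Qed.

Lemma actE (f : fseq A) (g : fseq F) k : act f g k = @conv R M f g k.
Proof. by []. Qed.

(** Convolution with a one-term sequence is a shift; this reduces the compatibility of projections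
    with homogeneous scalars to index arithmetic. *)
Lemma conv_monol i a g k : pow_smul n i (a : R^o) ->
  @conv R M (mono A i a) g k = if (i <= k)%N then a *: (g (k - i)%N : M) else 0.
Proof.
move=> ha; rewrite /conv; case: leqP => [ik|ki].
  rewrite (bigD1 (Ordinal (ik : (i < k.+1)%N))) //= (asboolT ha) eqxx big1 ?addr0 //.
  by move=> j; rewrite -val_eqE /= => /negPf->; rewrite scale0r.
rewrite big1 // => j _; rewrite /= ltn_eqF ?scale0r //.
exact: leq_trans (ltn_ord j) ki.
Qed.

Lemma conv_monor a j (y : M) k : F j y ->
  conv a (mono F j y) k = if (j <= k)%N then a (k - j)%N *: y else 0.
Proof.
move=> hy; rewrite /conv; case: leqP => [jk|kj].
  rewrite (bigD1 (Ordinal (leq_subr j k : (k - j < k.+1)%N))) //= (asboolT hy).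
  rewrite subKn // eqxx big1 ?addr0 // => i; rewrite -val_eqE /= => ne.
  case: eqP => [e|_]; last by rewrite scaler0.
  by case/eqP: ne; rewrite -e subKn // -ltnS.
rewrite big1 // => i _; rewrite /= ltn_eqF ?scaler0 //.
by apply: leq_ltn_trans kj; rewrite leq_subr.
Qed.

End GrModule.

Definition gr_ring_proj (e : int) (p : P) : P := @gr_proj R^o A e p.

Lemma gr_graded_module (M : lmodType R) (F : filtration n M) :
  @graded_module P (gr_ring_deg n) (gr F) (gr_deg F) gr_ring_proj (@gr_proj M F).
Proof.
split.
- by case=> [i|i] //=; exists 0; [exact: fil_zero | rewrite symbol0].
- case=> [i|i] x y; last by move=> /= -> ->; rewrite subr0.
  by move=> [u hu ->] [v hv ->]; exists (u - v); [exact: filB | rewrite symbolB].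
- case=> [i|i] f p x; last first.
    move=> /= -> _; rewrite scale0r; case: (_ + _) => k //.
    by exists 0; [exact: fil_zero | rewrite symbol0].
  case: f => [j|j]; last first.
    move=> _ /= ->; rewrite scaler0; case: (_ + _) => k //.
    by exists 0; [exact: fil_zero | rewrite symbol0].
  move=> [a ha ->] [y hy ->]; exists (a *: y); first exact: pow_fil.
  exact: gr_scale_symbol.
- by case.
- exact: gr_projB.
- exact: gr_proj_deg.
- exact: gr_proj_id.
- exact: gr_proj_ne.
- case=> [i|i] f p x; last by move=> p0; rewrite (p0 : p = 0) !scale0r gr_proj0.
  move=> [a ha ->]; have [g ->] := gr_pi x; have [hg _] := fseqP g.
  rewrite [_ *: \pi_(gr F) g]gr_scaleE; case: f => [j|j].
    rewrite -[Posz i + Posz j]/(Posz (i + j)%N) !gr_projE gr_scale_symbol //.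
    by rewrite actE conv_monol // leq_addr addKn.
  rewrite [gr_proj _ (\pi_(gr F) g)]/= scaler0.
  (* The total degree k can be nonnegative although [f] is negative; then k < i, where the shifted
     sequence has no entry. *)
  case E: (Posz i + Negz j) => [k|k] //; rewrite gr_projE actE conv_monol // leqNgt.
  by rewrite (_ : (k < i)%N) ?symbol0 //; lia.
- move=> e [j|j] p x; last by move=> x0; rewrite (x0 : x = 0) !scaler0 gr_proj0.
  move=> [y hy ->]; have [g ->] := gr_pi p; have [hg _] := fseqP g.
  rewrite [_ *: symbol F j y]gr_scaleE; case: e => [i|i].
    rewrite -[Posz i + Posz j]/(Posz (i + j)%N) [gr_ring_proj _ _]gr_projE gr_projE
      gr_scale_symbol //; last exact: hg.
    by rewrite actE conv_monor // leq_addl addnK.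
  rewrite [gr_ring_proj _ _]/= scale0r.
  case E: (Negz i + Posz j) => [k|k] //; rewrite gr_projE actE conv_monor // leqNgt.
  by rewrite (_ : (k < j)%N) ?symbol0 //; lia.
- move=> x; have [f e] := gr_pi x; have [hf [k hk]] := fseqP f.
  exists k => k' kk'; apply/eqP; rewrite -subr_eq0; apply/eqP; apply: gr_sep => i.
  have prs0 I (r : seq I) (E : I -> gr F) :
      gr_proj (Posz i) (\sum_(l <- r) E l) = \sum_(l <- r) gr_proj (Posz i) (E l).
    elim: r => [|l r IH]; first by rewrite !big_nil gr_proj0.
    rewrite !big_cons -IH -[E l in LHS]opprK addrC gr_projB.
    rewrite -[- E l]sub0r gr_projB.
    by rewrite gr_proj0 sub0r opprK addrC.
  rewrite gr_projB prs0; have [ik|ki] := ltnP i k'.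
    rewrite (bigD1 (Ordinal ik)) // big1.
      by rewrite [X in _ - X]addr0 [gr_proj _ (gr_proj _ _)](gr_proj_id (gr_proj_deg
        (Posz i) x)) subrr.
    move=> l li.
    apply: (gr_proj_ne (f := Posz l)); first exact: gr_proj_deg.
    by case=> e'; move: li; rewrite -val_eqE /= -e' eqxx.
  rewrite {1}e gr_projE hk ?symbol0 ?sub0r; last exact: leq_trans ki.
  rewrite big1 ?oppr0 // => l _; apply: (gr_proj_ne (f := Posz l)); first exact: gr_proj_deg.
  by case=> e'; move: (ltn_ord l); rewrite -e' ltnNge ki.
Qed.

Section Ring.
Hypotheses (hn : local_ring n) (hR : noetherian R).

Lemma pow_smul1 (a : R^o) : pow_smul n 1 a <-> n a.
Proof.
split=> [|na]; last by rewrite -[a]mulr1; apply: (@smul_mem _ R^o _ setT).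
apply: smul_min; first exact: local_ideal hn.
move=> b c nb _; rewrite -[b *: c]/(b * c) mulrC.
exact: submoduleZ (local_ideal hn) nb.
Qed.

Lemma symbol_mul i j (a b : R) : pow_smul n i (a : R^o) -> pow_smul n j (b : R^o) ->
  (symbol A i a : P) * symbol A j b = symbol A (i + j)%N (a * b : R^o).
Proof. exact: (@gr_scale_symbol R n R^o A). Qed.

(** n^(i+1) is generated by products of an element of n with one of n^i, and the symbol of such a
    product is the product of the symbols. *)
Lemma gr_std_graded e p : (0 < e)%R -> gr_ring_deg n e p ->
  smul setT (gr_ring_deg n 1 : set P^o) p.
Proof.
case: e => [[|i]|i] // _ [a ha ->].
pose B : set R^o := [set x | pow_smul n i.+1 x /\ smul setT (gr_ring_deg n 1 : set P^o)
  (symbol A i.+1 x)].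
suff [] : B a by [].
have hS := @smul_setT_submodule P P^o (gr_ring_deg n 1).
apply: (smul_min _ _ ha).
  split.
  - split; first exact: (fil_zero A i.+1).
    by rewrite symbol0; apply: submodule0 hS.
  - move=> x y [hx sx] [hy sy]; split; first exact: (fil_add (F := A) hx hy).
    by rewrite (symbolD (F := A)) //; apply: submoduleD hS sx sy.
  - move=> c x [hx sx]; split; first exact: (fil_scale (F := A) c hx).
    rewrite -[i.+1]add0n -(@gr_scale_symbol R n R^o A 0 i.+1) //.
    exact: submoduleZ hS sx.
move=> x y nx hy; have hx := (pow_smul1 x).2 nx; split.
  exact: (@pow_smul_mul R n R^o).
rewrite -[x *: y]mulrC; change (smul setT (gr_ring_deg n 1 : set P^o) (symbol A i.+1 (y *
  x : R^o))).
rewrite -[i.+1]addn1 -symbol_mul //; apply: (@smul_mem P P^o) => //.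
by exists x.
Qed.

End Ring.
End AssociatedGraded.

Section GrRing.
Variables (R : comNzRingType) (n : set R).
Notation A := (adic n R^o).
Notation P := (gr_ring n).
Hypotheses (hn : local_ring n) (hR : noetherian R).
Let gA := @gr_graded_module R n R^o A.

Lemma gr_ring_proj_eq0 (p : P) (f : fseq A) : p = \pi_(gr A) f -> @gr_ring_proj R n 0 p =
  0 <-> n (f 0%N).
Proof.
move=> ->; rewrite /gr_ring_proj gr_projE symbol_eq0; last exact: (fseqP f).1.
exact: (pow_smul1 hn).
Qed.

Lemma gr_ring_proj0_mul (a q : P) : @gr_ring_proj R n 0 q = 0 -> @gr_ring_proj R n 0 (a * q) = 0.
Proof.
have [f ef] := gr_pi (a : gr A); have [g eg] := gr_pi (q : gr A).
move/(gr_ring_proj_eq0 eg) => h; apply/(@gr_ring_proj_eq0 _ (act f g)).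
  by rewrite ef eg [_ * _]gr_scaleE.
by rewrite actE /conv big_ord1; apply: submoduleZ (local_ideal hn) h.
Qed.

Lemma gr_ring_proj0_submodule : submodule [set q : P^o | @gr_ring_proj R n 0 q = 0].
Proof.
split=> [|x y /= hx hy|a x /=]; [exact: gr_proj0| |exact: gr_ring_proj0_mul].
by have := prD gA 0 x y => /= h; rewrite [LHS]h [X in X + _]hx [X in _ + X]hy addr0.
Qed.

Lemma gr_irrelevant (p : P) : irrelevant (gr_ring_deg n) p <-> @gr_ring_proj R n 0 p = 0.
Proof.
split.
  apply: (smul_min gr_ring_proj0_submodule) => a q _ [j j0 qj]; apply: gr_ring_proj0_mul.
  by apply: (gr_proj_ne qj) => j00; rewrite -j00 ltxx in j0.
move=> p0; have [k /(_ k (leqnn k)) e] := pr_sum gA p.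
rewrite [p]e; apply: submodule_sum; first exact: smul_setT_submodule.
move=> [[|i] ik] _ /=; first by rewrite [X in irrelevant _ X]p0; apply: submodule0;
  apply: smul_setT_submodule.
by apply: smul_setT_mem; exists (Posz i.+1) => //; apply: (@gr_proj_deg _ _ _ A (Posz i.+1)).
Qed.

Lemma gr_deg0_field (p : P) : gr_ring_deg n 0 p ->
  p = 0 \/ exists2 q, gr_ring_deg n 0 q & q * p = 1.
Proof.
move=> [a ha ->]; have [na|/(local_unit hn)[b hb]] := pselect (n a).
  by left; apply/symbol_eq0 => //; apply/(pow_smul1 hn).
right; exists (symbol A 0 b); first by exists b.
by rewrite symbol_mul // hb.
Qed.

(** Rows of linear forms are the images under [th] of matrices over R, holding coefficients with
    respect to generators [nu] of n. The preimage of [Z] lies in a free R-module of finite rank, so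
    it is finitely generated, and its generators give the rows of [D]. *)
Lemma gr_degree1_fg b (Z : set 'rV[P]_b) : submodule Z ->
    exists m (D : 'M[P]_(m, b)), [/\ forall a c, gr_ring_deg n 1 (D a c),
      forall a, Z (row a D) &
      forall z, Z z -> (forall c, gr_ring_deg n 1 (z 0 c)) ->
        exists2 w : 'rV[P]_m, forall a, gr_ring_deg n 0 (w 0 a) & z = w *m D].
Proof.
move=> hZ; have nid := local_ideal hn.
have [g [nu hnu]] := hR nid.
have nnu l : n (nu l).
  rewrite hnu; exists (fun k => (k == l)%:R).
  rewrite (bigD1 l) //= eqxx scale1r big1 ?addr0 // => k /negPf->.
  by rewrite scale0r.
pose cmb (C : 'M[R]_(g, b)) c : R^o := \sum_l C l c * nu l.
have ncmb C c : pow_smul n 1 (cmb C c).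
  apply/(pow_smul1 hn); rewrite /cmb; apply: (@submodule_sum R R^o n) => // l _.
  exact: submoduleZ nid (nnu l).
pose th (C : 'M[R]_(g, b)) : 'rV[P]_b := \row_c symbol A 1 (cmb C c).
have thD C C' : th (C + C') = th C + th C'.
  apply/rowP => c; rewrite !mxE -[RHS](symbolD (F := A)) ; try exact: ncmb.
  congr (symbol A 1 _).
  by rewrite /cmb -big_split; apply: eq_bigr => l _; rewrite mxE mulrDl.
have thZ a C : th (a *: C) = (symbol A 0 a : P) *: th C.
  apply/rowP => c; rewrite !mxE [RHS](symbol_mul (i := 0)) //; try exact: ncmb.
  congr (symbol A 1 _).
  by rewrite /cmb mulr_sumr; apply: eq_bigr => l _; rewrite mxE mulrA.
have th0 : th 0 = 0.
  by rewrite -(scale0r (0 : 'M[R]_(g, b))) thZ symbol0 scale0r.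
pose Y := [set C | Z (th C)].
have hY : submodule Y.
  split=> [|C C' /= hC hC'|a C /= hC]; rewrite /Y /= ?th0 ?thD ?thZ.
  - exact: submodule0.
  - exact: submoduleD.
  - exact: submoduleZ.
have h0 := @submodule_set0 R 'M[R]_(g, b).
have [|s hs] := @noetherian_span R hR 'M[R]_(g, b)
    [seq delta_mx ij.1 ij.2 | ij <- enum {: 'I_g * 'I_b}] Y hY.
  move=> C _; rewrite [C]matrix_sum_delta; have hsp := span_submodule _ h0.
  apply: submodule_sum; first exact: hsp.
  move=> i _; apply: submodule_sum; first exact: hsp.
  move=> j _; apply: submoduleZ; first exact: hsp.
  by apply: span_mem => //; apply/mapP; exists (i, j) => //; rewrite mem_enum.
exists (size s), (\matrix_a th (nth 0 s a)); split.
- by move=> a c; rewrite !mxE; exists (cmb (nth 0 s a) c); first exact: ncmb.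
- move=> a; rewrite rowK; suff: Y (nth 0 s a) by [].
  by rewrite hs; apply: span_mem => //; apply: mem_nth.
move=> z Zz hz.
have /choice[C hC] c : exists d : 'I_g -> R, z 0 c = symbol A 1 (\sum_l d l * nu l : R^o).
  have [x /(pow_smul1 hn) nx ->] := hz c.
  by move: nx; rewrite hnu => -[d ->]; exists d.
pose C0 : 'M[R]_(g, b) := \matrix_(l, c) C c l.
have ez : z = th C0.
  apply/rowP => c; rewrite mxE hC; congr (symbol A 1 _).
  by apply: eq_bigr => l _; rewrite mxE.
have : Y C0 by rewrite /Y /= -ez.
rewrite hs ez.
apply: (@span_min _ _ _ [set C | exists2 w : 'rV[P]_(size s),
  forall a, gr_ring_deg n 0 (w 0 a) & th C = w *m \matrix_a th (nth 0 s a)]).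
- have gr0 := hom0 gA; have grD := homD gA.
  split=> [|C1 C2 /= [w hw e] [w' hw' e']|a C1 /= [w hw e]].
  + by exists 0; rewrite ?mul0mx // => a; rewrite mxE; apply: gr0.
  + exists (w + w'); rewrite ?thD ?mulmxDl ?e ?e' // => a; rewrite mxE; exact: (grD 0).
  + exists ((symbol A 0 a : P) *: w); rewrite ?thZ -?scalemxAl ?e // => k.
    by rewrite mxE; apply: (homZ gA (e := Posz 0) (f := Posz 0) _ (hw k)); exists a.
- by move=> _ ->; exists 0; rewrite ?th0 ?mul0mx // => a; rewrite mxE; apply: (hom0 gA).
move=> C1 C1s; have lt : (index C1 s < size s)%N by rewrite index_mem.
exists (delta_mx 0 (Ordinal lt)).
  move=> a; rewrite mxE; case: (_ && _); last exact: (hom0 gA).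
  by exists 1.
by rewrite -rowE rowK /= nth_index.
Qed.

Lemma gr_ring_graded : graded_ring (gr_ring_deg n) (@gr_ring_proj R n).
Proof.
split.
- by case: gA => *; split.
- by exists 1.
- exact: gr_irrelevant.
- exact: gr_deg0_field.
- exact: (gr_std_graded hn).
- exact: gr_degree1_fg.
Qed.

(** * Components of the associated graded module and powers of n *)

Section Components.
Variables (M : lmodType R) (F : filtration n M).

Definition npow j (Y : set M) : set M := iter j (smul n) Y.

Lemma npow_submodule j Y : submodule Y -> submodule (npow j Y).
Proof. by move=> hY; elim: j => //= j; apply: smul_submodule. Qed.

Lemma smul_sub (Y Z : set M) : Y `<=` Z -> smul n Y `<=` smul n Z.
Proof. by move=> YZ _ [s [hs ->]]; exists s; split=> // p /hs[? /YZ]. Qed.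

Lemma npow_sub j Y Z : Y `<=` Z -> npow j Y `<=` npow j Z.
Proof. by move=> YZ; elim: j => //= j; apply: smul_sub. Qed.

Lemma npowS j Y : npow j.+1 Y = npow j (smul n Y).
Proof. by rewrite /npow iterSr. Qed.

Lemma npowD i j Y : npow (i + j) Y = npow i (npow j Y).
Proof. by rewrite /npow iterD. Qed.

Lemma npow_mul j Y a x : submodule Y -> pow_smul n j (a : R^o) -> Y x -> npow j Y (a *: x).
Proof.
move=> hY; elim: j a => [|j IH] a ha Yx; first exact: submoduleZ.
apply: (@smul_min R R^o n _ [set b | npow j.+1 Y (b *: x)] _ _ _ ha).
  have hS := npow_submodule j.+1 hY; split=> [|b c /= hb hc|b c /= hc].
  - by rewrite /= scale0r; apply: submodule0.
  - by rewrite scalerDl; apply: submoduleD.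
  - by rewrite -[b *: c]/(b * c) -scalerA; apply: submoduleZ.
move=> b c nb hc /=; rewrite -[b *: c]/(b * c) -scalerA.
by apply: smul_mem => //; apply: IH.
Qed.

Lemma npow_nmul j Y a x : n a -> npow j Y x -> npow j.+1 Y (a *: x).
Proof. exact: smul_mem. Qed.

Lemma npow_fil j t : npow j (F t) `<=` F (j + t)%N.
Proof.
elim: j => // j IH; apply: smul_min; first exact: fil_submodule.
by move=> a x na /IH h; apply: fil_mul.
Qed.

Lemma fil_le i j : (i <= j)%N -> F j `<=` F i.
Proof.
elim: j => [|j IH]; first by rewrite leqn0 => /eqP->.
rewrite leq_eqVlt => /orP[/eqP->//|/IH]; apply: subset_trans; exact: fil_desc.
Qed.

(** With [component_symbol], this identifies the degree j + t part of G_<t> with the image of n^j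
    M_t: the dictionary by which linearity of G_<t> speaks about M. *)
Lemma symbol_component j t x : npow j (F t) x ->
  component (gr_deg F) t%:Z (j + t)%N%:Z (symbol F (j + t)%N x).
Proof.
move=> hx; split; first by exists x => //; apply: npow_fil.
have hS := @smul_setT_submodule P (gr F) (gr_deg F t%:Z).
elim: j x hx => [|j IH] x hx.
  by apply: smul_setT_mem; exists x.
suff [] : (npow j.+1 (F t) `&`
  [set y | smul setT (gr_deg F t%:Z) (symbol F (j.+1 + t)%N y)]) x by [].
apply: (smul_min _ _ hx).
  have hp := npow_submodule j.+1 (fil_submodule F t); split.
  - by split; [exact: submodule0 | rewrite /= symbol0; apply: submodule0].
  - move=> y z [hy sy] [hz sz]; split; first exact: submoduleD.
    by rewrite /= symbolD; [exact: submoduleD | exact: (@npow_fil j.+1) | exact: (@npow_fil j.+1)].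
  - move=> a y [hy sy]; split; first exact: submoduleZ.
    have Fy := @npow_fil j.+1 t _ hy.
    rewrite /= -[symbol _ _ _](@gr_scale_symbol R n M F 0 (j.+1 + t)%N a y) //.
    exact: submoduleZ.
move=> a y na hy; split; first exact: smul_mem.
have Fy := npow_fil hy; have p1 := (pow_smul1 hn a).2 na.
rewrite /= -[symbol _ _ _](@gr_scale_symbol R n M F 1 (j + t) a y) //.
by apply: submoduleZ => //; apply: IH.
Qed.

Lemma component_symbol j t z : component (gr_deg F) t%:Z (j + t)%N%:Z z ->
  exists2 x, npow j (F t) x & z = symbol F (j + t)%N x.
Proof.
move=> [Gz [s [hs e]]]; have gM := @gr_graded_module R n M F.
rewrite -(pr_id gM Gz) e (prs gM) {e}; elim: s hs => [|p s IH] hs.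
  rewrite big_nil; exists 0; last by rewrite symbol0.
  by apply: submodule0; apply: npow_submodule; apply: fil_submodule.
have [|x hx ex] := IH; first by move=> q qs; apply: hs; rewrite inE qs orbT.
rewrite big_cons; have [_ [y hy ey]] := hs p (mem_head _ _).
have Gp2 : gr_deg F t%:Z p.2 by exists y.
(* Projecting a term to degree j + t replaces its coefficient by the component of degree j, which is
   the symbol of an element of n^j. *)
rewrite PoszD (prZr gM _ _ Gp2) -PoszD ex ey.
have [a ha ea] := @gr_proj_deg R n R^o A j%:Z p.1.
rewrite [gr_ring_proj _ _]ea [X in X + _]gr_scale_symbol // -symbolD.
- exists (a *: y + x) => //; apply: submoduleD hx => //.
    by apply: npow_submodule; apply: fil_submodule.
  exact: npow_mul (fil_submodule F t) ha hy.
- exact: pow_fil.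
- exact: npow_fil.
Qed.

End Components.
End GrRing.

(** * Minimal generators of a filtered module *)

Section Generators.
Variables (R : comNzRingType) (n : set R).
Notation A := (adic n R^o).
Notation P := (gr_ring n).
Hypotheses (hn : local_ring n) (hR : noetherian R).
Variables (M : lmodType R) (F : filtration n M).
Hypotheses (hM0 : exists x : M, x <> 0) (hMfg : fin_gen [set: M]) (hF : stable F).

Lemma stable_sub : exists T, F T `<=` smul n setT.
Proof.
have [j hj] := hF; exists j.+1; rewrite -hj //; exact: smul_sub.
Qed.

Lemma nM_proper : smul n [set: M] <> setT.
Proof.
move=> h; have [m /generated_by_span[e [_ he]]] := hMfg.
have h0 : [set 0] = [set: M].
  apply: (nakayama hn (submodule_set0 _) (esym he)) => v; exists 0, v.
  by rewrite add0r h.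
have [x x0] := hM0; apply: x0.
by have : [set: M] x by []; rewrite -h0.
Qed.

(** Any nonzero degree in the stable range will do, since there F_(d+1) = n F_d. If there is none,
    the last nonzero degree has a zero successor; it exists because M differs from n M. *)
Lemma exists_top_degree : exists d x, [/\ F d x, ~ F d.+1 x &
  gr_deg F (d.+1)%:Z `<=` smul (setT : set P) (gr_deg F d%:Z)].
Proof.
have [j0 hj0] := hF.
pose Q d := `[< exists2 x, F d x & ~ F d.+1 x >].
have [[j [jj [x Fx nFx]]]|hnone] := pselect (exists j, (j0 <= j)%N /\ exists2 x, F j x &
  ~ F j.+1 x).
  exists j, x; split=> // z [y]; rewrite -hj0 // => hy ->.
  by have [_] := symbol_component hn (hy : npow n 1 (F j) y).
have stab j : (j0 <= j)%N -> F j `<=` F j.+1.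
  move=> jj x Fx; apply: contrapT => nFx; apply: hnone; exists j; split=> //.
  by exists x.
have exQ : exists d, Q d.
  apply: contrapT => nQ; apply: nM_proper; apply/seteqP; split=> // x _.
  have all j : F j x.
    elim: j => [|j IH]; first by rewrite fil0.
    by apply: contrapT => nFx; apply: nQ; exists j; apply/asboolP; exists x.
  have := all j0.+1; rewrite -hj0 //; exact: smul_sub.
have ub d : Q d -> (d <= j0)%N.
  move=> /asboolP[x Fx nFx]; rewrite leqNgt; apply/negP => jd.
  by apply: nFx; apply: stab (ltnW jd) _ Fx.
have [d /asboolP[x Fx nFx] max] := ex_maxnP exQ ub.
exists d, x; split=> // z [y hy ->].
have -> : symbol F d.+1 y = 0.
  apply/symbol_eq0 => //; apply: contrapT => nFy.
  suff : (d.+1 <= d)%N by rewrite ltnn.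
  by apply: max; apply/asboolP; exists y.
by apply: submodule0; apply: smul_setT_submodule.
Qed.

(** A P-submodule that carries generation back to M: if it is everything, elements of [Y]
    approximate every vector to any order of the filtration. *)
Definition rep_in (Y : set M) : set (gr F) :=
  [set z | exists2 f : fseq F, z = \pi_(gr F) f & forall j, Y (f j)].

Lemma rep_in_submodule Y : submodule Y -> submodule (rep_in Y : set (gr F)).
Proof.
move=> hY; split=> [|z w [f -> hf] [g -> hg]|a z [f -> hf]].
- exists (mono F 0 0); first exact: (esym (symbol0 F 0)).
  by move=> j; rewrite monoE ?if_same; [apply: submodule0 | apply: fil_zero].
- by exists (f + g); [rewrite gr_piD | move=> j; exact: submoduleD hY (hf j) (hg j)].
- have [al ->] := gr_pi (a : gr A); exists (act al f); first exact: gr_scaleE.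
  by move=> j; rewrite actE; apply: submodule_sum => // i _; apply: submoduleZ.
Qed.

Lemma irrelevant_scale (p : P) (v : gr F) : @gr_ring_proj R n 0 p = 0 ->
  exists al g, [/\ p *: v = \pi_(gr F) (act al g), n (al 0%N) & forall i, pow_smul n i
    (al i : R^o)].
Proof.
have [al eal] := gr_pi (p : gr A); have [g ->] := gr_pi v.
move=> /(gr_ring_proj_eq0 hn eal) h; exists al, g; split=> //; last by have [] := fseqP al.
by rewrite eal; exact: gr_scaleE.
Qed.

Lemma pow_smulS_n i (a : R^o) : pow_smul n i.+1 a -> n a.
Proof.
move=> h; apply/(pow_smul1 hn); elim: i a h => // i IH a h; apply: IH.
exact: pow_smul_desc h.
Qed.

(* A counterexample [x] would give a minimal generator of [gr F] lying in [n M];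
   completing it to a system of [m] homogeneous generators, the other [m - 1]
   generate [M] by Nakayama. *)
Lemma filtration_generators m : is_mu [set: M] m -> is_mu [set: gr F] m ->
  forall t x, smul n setT x -> F t.+1 x ->
  exists2 y, smul n (F t) y & F t.+2 (x - y).
Proof.
move=> [_ minM] [genG _] t x nx Fx; apply: contrapT => nex.
have gM := @gr_graded_module R n M F.
have [g [sg hg]] := generated_by_span genG.
pose I := [set p : P | @gr_ring_proj R n 0 p = 0].
have hI p : I p \/ exists q, I (q * p - 1) by apply: residue_dichotomy (gr_ring_graded hn hR) _.
have IM a p : I p -> I (a * p) by apply: gr_ring_proj0_mul.
pose A1 : set (gr F) := smul I setT.
have hA1 : submodule A1 by apply: smul_ideal_submodule.
have IA1 w p : I p -> A1 (p *: w) by move=> Ip; apply: smul_mem.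
pose xs := symbol F t.+1 x.
(* Otherwise the degree t + 1 part of the combination is the symbol of an element of n F_t, since
   n^(i+1) F_(t-i) lies in n F_t, against the choice of [x]. *)
have nAxs : ~ A1 xs.
  move=> [s [hs e]]; apply: nex.
  have [y hy ey] : exists2 y, smul n (F t) y & gr_proj (Posz t.+1) xs = symbol F t.+1 y.
    rewrite e (prs gM) big_seq; elim/big_ind: _ => [|z w [y hy ->] [y' hy' ->]|q /hs[Iq _]].
    - by exists 0; [apply: submodule0; apply: smul_submodule; apply: fil_submodule |
      rewrite symbol0].
    - exists (y + y'); first by apply: submoduleD => //; apply: smul_submodule; apply:
      fil_submodule.
      rewrite symbolD //.
        exact: (npow_fil (hy : npow n 1 (F t) y)).
      exact: (npow_fil (hy' : npow n 1 (F t) y')).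
    - have [al [f [-> al0 hal]]] := irrelevant_scale q.2 Iq; have [hf _] := fseqP f.
      rewrite gr_projE actE convS.
      have hy : smul n (F t) (conv (fun i => al i.+1) f t).
        apply: submodule_sum; first by apply: smul_submodule; apply: fil_submodule.
        move=> i _; have it : (i <= t)%N by rewrite -ltnS.
        have h : npow n i.+1 (F (t - i)%N) (al i.+1 *: f (t - i)%N).
          by apply: npow_mul => //; apply: fil_submodule.
        apply: smul_sub h => z hz; rewrite -(subnKC it); exact: npow_fil hz.
      exists (conv (fun i => al i.+1) f t) => //.
      have hyF : F t.+1 (conv (fun i => al i.+1) f t) by apply: (npow_fil (hy : npow n 1 (F t) _)).
      have hal0 : F t.+2 (al 0%N *: f t.+1) by apply: fil_mul.
      apply/symbol_eq => //; last by rewrite addrK.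
      by apply: fil_add => //; apply: fil_desc.
  exists y => //; apply/symbol_eq => //; first exact: (npow_fil (hy : npow n 1 (F t) y)).
  by rewrite -ey; apply/esym; apply: gr_proj_id; exists x.
have h0 := @submodule_set0 P (gr F).
have gT z : span_over A1 g z.
  have : span_over [set 0] g z by rewrite -hg.
  apply: (span_min (span_submodule g hA1)) => [_ ->|y]; last exact: span_mem.
  by apply: submodule0; apply: span_submodule.
have [g' [sg' hg']] := span_remove hI hA1 IA1 (gT xs) nAxs.
pose T := [set z : gr F | exists j y, F j y /\ z = symbol F j y].
(* The base already contains [xs], so the exchange makes the remaining generators homogeneous, hence
   symbols that lift to M. *)
have [|w p Ip|B hB AB TB||s' [ss' s'T es']] :=
    @span_replace _ _ I hI (span_over A1 [:: xs]) T g'.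
- exact: span_submodule.
- by apply: span_base => //; apply: IA1.
- apply/seteqP; split=> // z _; have [k /(_ k (leqnn k)) ->] := pr_sum gM z.
  apply: submodule_sum => // e _; apply: TB; have [y hy ->] := gr_proj_deg (F := F) (Posz e) z.
  by exists e, y.
- by rewrite span_consA //; apply/seteqP; split=> // z _; apply: hg'.
have /choice[lf hlf] z : exists y, T z -> exists2 j, F j y & z = symbol F j y.
  have [[j [y [hy ez]]]|nT] := pselect (T z); last by exists 0.
  by exists y => _; exists j.
pose X := span_over [set 0] [seq lf z | z <- s'].
have hX : submodule X by apply/span_submodule/submodule_set0.
pose Y : set M := [set v | exists u w, [/\ v = u + w, X u & smul n setT w]].
have hnM : submodule (smul n [set: M]) by apply: smul_submodule.
have hY : submodule Y.
  split=> [|v v' [u [w [-> Xu nw]]] [u' [w' [-> Xu' nw']]]|a v [u [w [-> Xu nw]]]].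
  - by exists 0, 0; rewrite addr0; split=> //; apply: submodule0.
  - by exists (u + u'), (w + w'); rewrite addrACA; split=> //; apply: submoduleD.
  - by exists (a *: u), (a *: w); rewrite scalerDr; split=> //; apply: submoduleZ.
have nY : smul n setT `<=` Y.
  by move=> v hv; exists 0, v; rewrite add0r; split=> //; apply: submodule0.
have mono_rep j y : F j y -> Y y -> rep_in Y (symbol F j y).
  move=> hy Yy; exists (mono F j y) => // i; rewrite monoE //.
  by case: ifP => // _; apply: submodule0.
have hrep := rep_in_submodule hY.
(* P_+ gr F is represented in n M by taking coefficients in n, and [xs] because [x] itself lies in n
   M; only the lifts of [s'] are left to contribute. *)
have rT z : rep_in Y z.
  have : span_over (span_over A1 [:: xs]) s' z by rewrite es'.
  apply: span_min => //.
    apply: span_min => // [|z']; last by rewrite inE => /eqP->; apply: mono_rep => //; apply: nY.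
    apply: smul_min => // p v Ip _.
    have [al [f [-> al0 hal]]] := irrelevant_scale v Ip.
    exists (act al f) => // j; rewrite actE; apply: submodule_sum => // i _.
    apply: nY; apply: smul_mem => //; case: i => [[|i] hi] //=.
    exact: pow_smulS_n (hal i.+1).
  move=> z' z's; have [j hj ->] := hlf z' (s'T _ z's); apply: mono_rep => //.
  exists (lf z'), 0; rewrite addr0; split=> //; last exact: submodule0.
  by apply: span_mem; [exact: submodule_set0 | apply: map_f].
(* Successive approximation; it stops once F_J lies in n M, which is contained in [Y]. *)
have YF j v : exists2 y, Y y & F j (v - y).
  elim: j => [|j [y Yy hy]]; first by exists 0; [exact: submodule0 | rewrite fil0].
  have [f e hf] := rT (symbol F j (v - y)).
  exists (y + f j); first exact: submoduleD.
  have := congr1 (gr_proj (Posz j)) e; rewrite gr_projE (gr_proj_id (F := F) (e := Posz j)).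
    by move=> /symbol_eq; rewrite opprD addrA; apply=> //; apply: (fseqP f).1.
  by exists (v - y).
have XT : X = setT.
  have [k /generated_by_span[e [_ he]]] := hMfg.
  apply: (nakayama hn hX (e := e)).
    apply/seteqP; split=> // v _; have : span_over [set 0] e v by rewrite -he.
    apply: span_min; [exact: span_submodule | |by move=> y; apply: span_mem].
    by move=> _ ->; apply: submodule0; apply: span_submodule.
  move=> v; have [J FJ] := stable_sub; have [y Yy hy] := YF J v.
  suff : Y v by [].
  by rewrite -(subrK y v); apply: submoduleD => //; apply: nY; apply: FJ.
have gen := @span_generated_by R M [seq lf z | z <- s'].
rewrite -/X XT in gen; have := minM _ gen.
by rewrite size_map -sg sg' => /leq_trans/(_ ss'); rewrite ltnn.
Qed.

(** Descending induction on t from the stable range: the error left by [filtration_generators] lies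
    in n M and in F_(t+2), hence in n F_(t+1). *)
Lemma nM_filtration : (exists m, is_mu [set: M] m /\ is_mu [set: gr F] m) ->
  forall t x, smul n setT x -> F t.+1 x -> smul n (F t) x.
Proof.
move=> [m [h1 h2]]; have [j0 hj0] := hF.
have large t x : (j0 <= t)%N -> smul n setT x -> F t.+1 x -> smul n (F t) x.
  by move=> jt _; rewrite hj0.
suff H k t x : (j0 - t <= k)%N -> smul n setT x -> F t.+1 x -> smul n (F t) x.
  by move=> t x; apply: (H (j0 - t)%N).
elim: k t x => [|k IH] t x hk nx Fx.
  by apply: large => //; rewrite -subn_eq0 -leqn0.
have [y hy hxy] := filtration_generators h1 h2 nx Fx.
have hS : submodule (smul n (F t)) by apply/smul_submodule/fil_submodule.
rewrite -(subrK y x); apply: submoduleD => //.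
apply: (smul_sub (@fil_desc _ _ _ F t)).
apply: IH => //; first by move: hk; lia.
apply: submoduleB => //; first exact: smul_submodule.
by apply: smul_sub hy.
Qed.

End Generators.

(** * Lifting the linear resolution to R *)

Section Lifting.
Variables (R : comNzRingType) (n : set R).
Notation A := (adic n R^o).
Notation P := (gr_ring n).
Notation Pd := (gr_ring_deg n).
Hypotheses (hn : local_ring n) (hR : noetherian R).
Let hP := gr_ring_graded hn hR.
Variables (C : cplx Pd).
Hypothesis hC : forall N, exact_upto N C /\ linear_upto N C.

Lemma lift_exists : exists D : forall i, 'M[R]_(crk C i.+1, crk C i),
  forall i a b, n (D i a b) /\ cdf C i a b = symbol A 1 (D i a b : R^o).
Proof.
have [_ [lin _ _]] := hC 0.
have h i a b : exists d, n d /\ cdf C i a b = symbol A 1 (d : R^o).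
  have := cdf_h C i a b; rewrite !lin.
  have -> : i.+1%:Z - i%:Z = 1 by lia.
  by move=> [d hd e]; exists d; split=> //; apply/(pow_smul1 hn).
have {}h i : exists D : 'M[R]_(crk C i.+1, crk C i),
    forall a b, n (D a b) /\ cdf C i a b = symbol A 1 (D a b : R^o).
  have [d hd] := choice (fun ab => h i ab.1 ab.2).
  by exists (\matrix_(a, b) d (a, b)) => a b; rewrite mxE; apply: (hd (a, b)).
by exists (fun i => projT1 (cid (h i))) => i; case: cid.
Qed.

Variable D : forall i, 'M[R]_(crk C i.+1, crk C i).
Hypothesis hD : forall i a b, n (D i a b) /\ cdf C i a b = symbol A 1 (D i a b : R^o).

Let Dn1 i a b : pow_smul n 1 (D i a b : R^o).
Proof. by apply/(pow_smul1 hn); case: (hD a b). Qed.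

(** The entries lie in n^2, and their symbols of degree 2 are the entries of a product of
    consecutive differentials, which is zero. *)
Lemma lift_dd i a c : pow_smul n 3 ((D i.+1 *m D i) a c : R^o).
Proof.
have [eC _] := hC i.+2; have := congr1 (fun X : 'M_(_,_) => X a c) (exact_dd eC (ltnSn _)).
rewrite !mxE; under eq_bigr => b _ do
  rewrite (hD a b).2 (hD b c).2 (symbol_mul (i := 1) (j := 1)) //.
rewrite -(symbol_sum (F := A) (i := 2)).
  move/symbol_eq0; apply; apply: (@fil_sum R n R^o A 2) => b _.
  by apply: (@pow_fil R n R^o A 1 1); apply: Dn1.
by move=> b _; apply: (@pow_fil R n R^o A 1 1); apply: Dn1.
Qed.

Section ModuleLifting.
Variables (M : lmodType R).

Lemma mx_act_npow i j (Y : set M) v : submodule Y -> (forall a, npow n j Y (v a)) ->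
  forall b, npow n j.+1 Y (mx_act (D i) v b).
Proof.
move=> hY hv b; apply: submodule_sum; first exact: npow_submodule.
by move=> a _; apply: npow_nmul => //; case: (hD a b).
Qed.

Lemma mx_act_act_npow i j (Y : set M) v : submodule Y -> (forall a, npow n j Y (v a)) ->
  forall b, npow n (3 + j) Y (mx_act (D i) (mx_act (D i.+1) v) b).
Proof.
move=> hY hv b; rewrite -mx_actM npowD; apply: submodule_sum.
  by apply: npow_submodule; apply: npow_submodule.
by move=> a _; apply: npow_mul; [exact: npow_submodule | exact: lift_dd | exact: hv].
Qed.

Lemma mx_act_symbol (F : filtration n M) i s v : (forall a, F s (v a)) ->
  mx_act (cdf C i) (fun a => symbol F s (v a)) =
  fun b => symbol F s.+1 (mx_act (D i) v b).
Proof.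
move=> hv; apply: funext => b; rewrite /mx_act symbol_sum.
  by apply: eq_bigr => a _; rewrite (hD a b).2 (gr_scale_symbol (i := 1)).
by move=> a _; apply: fil_mul => //; case: (hD a b).
Qed.

Lemma mx_act_fil (F : filtration n M) i s v : (forall a, F s (v a)) ->
  forall b, F s.+1 (mx_act (D i) v b).
Proof.
by move=> hv b; apply: fil_sum => a _; apply: fil_mul => //; case: (hD a b).
Qed.

(** Cycles up to an error in [Z]: since D D need not vanish over R, exact cycles would be too
    restrictive. *)
Definition cycle_in i (Z : set M) : ('I_(crk C i) -> M) -> Prop :=
  match i with
  | 0%N => fun=> True
  | i'.+1 => fun v => forall b, Z (mx_act (D i') v b)
  end.

(** [D] takes order s to s + 1 for any vector; the symbols form a cycle when one further order is
    gained, whence s + 2. *)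
Lemma cycle_symbol (F : filtration n M) i s (v : 'I_(crk C i) -> M) : (forall a, F s (v a)) ->
  cycle_in (F s.+2) v <-> is_cycle (fun a => symbol F s (v a)).
Proof.
case: i v => [//|i] v hv /=; split=> h b; have := h b; rewrite mx_act_symbol //.
  by move=> ?; apply/symbol_eq0 => //; apply: mx_act_fil.
by move/symbol_eq0; apply; apply: mx_act_fil.
Qed.

Lemma cycle_inB i (Z : set M) (v w : 'I_(crk C i) -> M) : submodule Z ->
  cycle_in Z v -> cycle_in Z w -> cycle_in Z (fun a => v a - w a).
Proof.
by case: i v w => [//|i] v w hZ hv hw b; rewrite mx_actB; apply: submoduleB.
Qed.

Lemma cycle_in_dd i s (Y : set M) (w : 'I_(crk C i.+1) -> M) : submodule Y ->
  (forall a, npow n s Y (w a)) -> cycle_in (npow n (3 + s) Y) (mx_act (D i) w).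
Proof.
by case: i w => [//|i] w hY hw b; apply: mx_act_act_npow.
Qed.

Lemma cycle_in_sub i (Z Z' : set M) (v : 'I_(crk C i) -> M) : Z `<=` Z' ->
  cycle_in Z v -> cycle_in Z' v.
Proof. by case: i v => [//|i] v ZZ hv b; apply: ZZ. Qed.

(** Exactness at place 0: for [a] in n the row with the symbol of [a] at [b0] is a P_0-combination
    of the rows of [cdf C 0], so [a] at [b0] is reached by [D 0] modulo n^2. A basis element [b0]
    exists since the augmentation is onto a nonzero residue ring. *)
Lemma degree_zero_lift : exists b0 : 'I_(crk C 0), forall (Y : set M) k x, submodule Y ->
  npow n k.+1 Y x -> exists2 v, forall l, npow n k Y (v l) &
    forall b, npow n k.+2 Y (mx_act (D 0%N) v b - (if b == b0 then x else 0)).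
Proof.
have [[onto ex0 _] [lb _ _]] := hC 1.
have [b0] : exists b0 : 'I_(crk C 0), True.
  apply: contrapT => none; have [u] := onto 1; rewrite mxE big1 ?subr0.
    by move=> /(gr_irr hP); rewrite (rpr_id hP (gr_hom1 hP)) => /(symbol_eq0 (F := A) (i := 0))
      -/(_ I) /(pow_smul1 hn) /(local_not1 hn).
  by move=> b; case: none; exists b.
move=> _; exists b0 => Y k x hY.
have hk := npow_submodule n k hY; have hk2 := npow_submodule n k.+2 hY.
pose good : set M := [set x | exists2 v, forall l, npow n k Y (v l) &
    forall b, npow n k.+2 Y (mx_act (D 0%N) v b - (if b == b0 then x else 0))].
suff hgood : smul n (npow n k Y) `<=` good by move=> hx; exact: (hgood x hx).
apply: smul_min.
  split=> [|y z [v hv ev] [w hw ew]|c y [v hv ev]].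
  - exists (fun=> 0) => [l|b]; first exact: submodule0.
    by rewrite if_same subr0 mx_act0 //; apply: submodule0.
  - exists (fun l => v l - - w l) => [l|b].
      by apply: submoduleB => //; apply: submoduleN.
    rewrite mx_actB (_ : mx_act (D 0%N) (fun l => - w l) b = - mx_act (D 0%N) w b).
      have := submoduleD hk2 (ev b) (ew b); rewrite opprK.
      by case: eqP; rewrite ?subr0 // addrACA opprD.
    by rewrite -[RHS]sub0r -[in RHS](mx_act0 (D 0%N) (v := fun=> 0) _ b) // -mx_actB /mx_act;
      apply: eq_bigr => l _; rewrite sub0r.
  - exists (fun l => c *: v l) => [l|b]; first exact: submoduleZ.
    have := submoduleZ c hk2 (ev b); rewrite scalerBr /mx_act scaler_sumr.
    under eq_bigr => l _ do rewrite scalerA mulrC -scalerA.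
    by case: eqP; rewrite ?scaler0.
move=> a y na hy; have pa := (pow_smul1 hn a).2 na.
have [w0 ew0] : exists w : 'rV_(crk C 1),
    (symbol A 1 a : P) *: delta_mx (0 : 'I_1) b0 = w *m cdf C 0.
  apply/(ex0 isT); rewrite -scalemxAl mxE; apply/(gr_irr hP).
  by rewrite mulrC; apply: gr_ring_proj0_mul => //; apply: (gr_proj_ne (f := 1)) => //; exists a.
have h1 : homog_row Pd (cbd C 0) 1 ((symbol A 1 a : P) *: delta_mx 0 b0).
  move=> i b; rewrite lb subr0 !mxE; case: (_ && _); rewrite ?mulr1 ?mulr0; first by exists a.
  exact: (rhom0 hP).
have [w hw ew] := homog_row_lift hP (cdf_h C 0) h1 (ex_intro _ w0 ew0).
have [om hom] : exists om : 'I_(crk C 1) -> R, forall l, w 0 l = symbol A 0 (om l : R^o).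
  have h l : exists c, w 0 l = symbol A 0 (c : R^o).
    have := hw 0 l; rewrite lb subrr => -[c _ e].
    by exists c.
  by have [om hom] := choice h; exists om.
exists (fun l => om l *: y) => [l|b]; first exact: submoduleZ.
have -> : mx_act (D 0%N) (fun l => om l *: y) b - (if b == b0 then a *: y else 0) =
    (\sum_l om l * D 0%N l b - (if b == b0 then a else 0)) *: y.
  rewrite scalerBl scaler_suml /mx_act; congr (_ - _).
    by apply: eq_bigr => l _; rewrite scalerA mulrC.
  by case: eqP; rewrite ?scale0r.
rewrite -[k.+2]/(2 + k)%N npowD; apply: npow_mul => //.
have Dn l c : pow_smul n 1 (om l * D 0%N l c : R^o).
  by apply: (@fil_scale R n R^o A 1); apply: Dn1.
have pif : pow_smul n 1 ((if b == b0 then a else 0) : R^o).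
  by case: eqP => // _; apply: (fil_zero A 1).
(* Membership of the scalar in n^2 is equality of two symbols of degree 1, supplied by [ew]. *)
apply/(symbol_eq (F := A) (i := 1)) => //.
  by apply: (fil_sum (F := A) (j := 1)) => l _; apply: Dn.
rewrite (symbol_sum (F := A)); last by move=> l _; apply: Dn.
have := congr1 (fun u : 'rV_(_) => u 0 b) ew; rewrite !mxE eqxx /= => e.
transitivity ((symbol A 1 a : P) * (b == b0)%:R).
  rewrite e; apply: eq_bigr => l _.
  by rewrite hom (hD l b).2 (symbol_mul (i := 0)).
by case: eqP; rewrite ?mulr1 // mulr0 symbol0.
Qed.

(** * From the filtration to the n-adic filtration *)

Section Filtered.
Variable F : filtration n M.
Hypothesis hvan : forall (t i : nat) j, j <> t%:Z + i%:Z ->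
  tor_vanish C (component (gr_deg F) t%:Z) i j.
Hypothesis hmu : forall t x, smul n setT x -> F t.+1 x -> smul n (F t) x.

Let Fsub t : submodule (F t) := fil_submodule F t.

Lemma component_exact t i s (v : 'I_(crk C i) -> M) :
  (forall a, npow n s.+1 (F t) (v a)) -> cycle_in (F (s.+1 + t).+2%N) v ->
  exists2 w, forall a, npow n s (F t) (w a) &
    forall a, F (s.+1 + t).+1%N (v a - mx_act (D i) w a).
Proof.
move=> hv cv; have [_ [lb _ _]] := hC 0.
have hvF a : F (s.+1 + t)%N (v a) by apply: npow_fil.
(* The coefficients have degree s + 1 + t, strictly above t, so the degree left open by linearity of
   G_<t> is avoided. *)
have [|a||W hW eW] := @hvan t i ((s.+1 + t)%N%:Z + i%:Z) _ (fun a => symbol F (s.+1 + t)%N (v a)).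
- lia.
- by rewrite lb addrK; apply: symbol_component.
- exact/cycle_symbol.
have /choice[w hw] a : exists x, npow n s (F t) x /\ W a = symbol F (s + t)%N x.
  have := hW a; rewrite lb.
  have -> : (s.+1 + t)%N%:Z + i%:Z - i.+1%:Z = (s + t)%N%:Z by lia.
  by move=> /component_symbol[x hx ex]; exists x.
exists w => [a|a]; first by case: (hw a).
have wF a' : F (s + t)%N (w a') by apply: npow_fil; case: (hw a').
apply/symbol_eq => //; first exact: (mx_act_fil wF).
have := congr1 (fun f => f a) eW; rewrite /= => ->.
have -> : W = fun a => symbol F (s + t)%N (w a) by apply: funext => a'; case: (hw a').
by rewrite mx_act_symbol.
Qed.

(** Induction on s, then on t. An [x] in n^(s+2) F_t is D_0 v at [b0] up to n^(s+3) F_t. If [x] lies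
    one order deeper, linearity of G_<t> lets v - D_1 w replace v and lie in F_(s+t+2), where the
    induction on s applies. *)
Lemma npow_cap_fil s t x : npow n s.+1 setT x -> F (s.+1 + t)%N x -> npow n s.+1 (F t) x.
Proof.
elim: s t x => [|s IHs] t x nx Fx.
  by apply: hmu.
elim: t => [|t IHt] in x nx Fx *; first by rewrite fil0.
have {}Fx : F (s.+1 + t).+2%N x by have -> : ((s.+1 + t).+2 = s.+2 + t.+1)%N by lia.
have Fx' : F (s.+2 + t)%N x by apply: fil_desc.
have {IHt}nx' := IHt x nx Fx'.
have [b0 /(_ (F t) s.+1 x (Fsub t) nx')[v hv Dv]] := degree_zero_lift.
have sub3 : npow n s.+3 (F t) `<=` npow n s.+2 (F t.+1).
  by rewrite npowS; apply: npow_sub; apply: smul_min => // a y na hy; apply: fil_mul.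
(* [D 0] sends [v] to [x] at [b0] up to n^(s+3) F_t; both lie in F_(s+t+3), which is the order
   required of a cycle. *)
have [b|w hw vw] := component_exact (i := 1) (s := s) hv.
  have hr := npow_fil (Dv b).
  apply: submoduleBr hr => //.
    by case: eqP => _; [exact: Fx | apply: fil_zero].
have hv' l : npow n s.+1 (F t.+1) (v l - mx_act (D 1) w l).
  apply: IHs; last by rewrite addnS.
  apply: (npow_sub (subsetT (F t))); apply: submoduleB; [exact: npow_submodule|exact: hv|].
  exact: mx_act_npow.
have hs := npow_submodule n s.+2 (Fsub t.+1).
have := Dv b0; rewrite eqxx => h.
have -> : x = mx_act (D 0) (fun l => v l - mx_act (D 1) w l) b0 + mx_act (D 0) (mx_act (D 1) w) b0
    - (mx_act (D 0) v b0 - x).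
  by rewrite mx_actB subrK opprB addrC subrK.
apply: submoduleB => //; last exact: sub3.
apply: submoduleD => //; first exact: mx_act_npow.
exact/sub3/mx_act_act_npow.
Qed.

Hypothesis hstab : exists T, F T `<=` smul n setT.

Lemma adic_exact i s (v : 'I_(crk C i) -> M) :
  (forall a, npow n s.+1 setT (v a)) -> cycle_in (npow n s.+3 setT) v ->
  exists2 w, forall a, npow n s setT (w a) &
    forall a, npow n s.+2 setT (v a - mx_act (D i) w a).
Proof.
have [T hT] := hstab; have hTT := @submodule_setT _ M.
suff H k t (u : 'I_(crk C i) -> M) : (T - t <= k)%N -> (forall a, npow n s.+1 (F t) (u a)) ->
    cycle_in (npow n s.+3 setT) u -> exists2 w, forall a, npow n s setT (w a) &
    forall a, npow n s.+2 setT (u a - mx_act (D i) w a).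
  by move=> hv; apply: (H (T - 0)%N 0%N) => //; rewrite fil0.
elim: k t u => [|k IH] t u ht hu cu.
  (* Here T <= t, so n^(s+1) F_t lies in n^(s+2) M and [u] is itself negligible. *)
  exists (fun=> 0) => a; first by apply: submodule0; apply: npow_submodule.
  rewrite mx_act0 // subr0 npowS; apply: npow_sub (hu a).
  apply: subset_trans hT; apply: fil_le; by rewrite -subn_eq0 -leqn0.
have [w' [hw1 hw2 cw]] : exists w', [/\ forall a, npow n s.+2 setT (w' a),
    forall a, npow n s.+1 (F t) (w' a) & cycle_in (F (s.+1 + t).+2%N) (fun a => u a - w' a)].
  have triv : cycle_in (F (s.+1 + t).+2%N) u -> exists w', [/\ forall a, npow n s.+2 setT (w' a),
    forall a, npow n s.+1 (F t) (w' a) & cycle_in (F (s.+1 + t).+2%N) (fun a => u a - w' a)].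
    move=> h; exists (fun=> 0); split=> [a|a|].
    - by apply: submodule0; apply: npow_submodule.
    - by apply: submodule0; apply: npow_submodule.
    - by rewrite (_ : (fun a => _) = u) //; apply: funext => a; rewrite subr0.
  (* For t = 0 there is no G_<t-1> to use, but n^(s+3) M lies in F_(s+3), which is already the
     required order. *)
  case: t ht hu triv => [|t] ht hu triv.
    apply: triv; apply: cycle_in_sub cu => x hx; rewrite addn0.
    by have := @npow_fil _ _ _ F s.+3 0; rewrite addn0 fil0; apply.
  case: (i) u hu cu triv => [|i'] u hu cu triv; first exact: triv.
  have hDu b : npow n s.+3 (F t) (mx_act (D i') u b).
    apply: npow_cap_fil; first exact: cu.
    have -> : (s.+3 + t = s.+2 + t.+1)%N by lia.
    by apply: npow_fil; apply: mx_act_npow.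
  have [|w' hw' ew'] := component_exact hDu.
    (* D D u has to lie in F_(s+t+5). With u in n^(s+1) F_(t+1) this is exactly what D D in n^3
       gives; n^2 would fall one order short. *)
    apply: (cycle_in_sub _ (cycle_in_dd (Fsub t.+1) hu)).
    apply: subset_trans (@npow_fil _ _ _ F (3 + s.+1) t.+1) _.
    by apply: fil_le; lia.
  exists w'; split=> [a|a|b].
  - exact: (npow_sub (subsetT (F t)) (hw' a)).
  - have := hw' a; rewrite npowS; apply: npow_sub.
    by apply: smul_min => // c y nc hy; apply: fil_mul.
  - rewrite mx_actB; apply: fil_le (ew' b); lia.
have [|w hw ew] := component_exact (v := fun a => u a - w' a) _ cw.
  by move=> a; apply: submoduleB => //; apply: npow_submodule.
pose u2 a := u a - w' a - mx_act (D i) w a.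
have hws a : npow n s setT (w a) by apply: (npow_sub (subsetT (F t))).
have h2 a : npow n s.+1 setT (u2 a).
  have hS := npow_submodule n s.+1 (Fsub t).
  apply: (npow_sub (subsetT (F t))); apply: submoduleB => //; last exact: mx_act_npow.
  exact: submoduleB.
have [|||w2 hw2' ew2] := IH t.+1 u2.
- by move: ht; lia.
- by move=> a; apply: npow_cap_fil => //; rewrite addnS; apply: ew.
- have hS := npow_submodule n s.+3 hTT.
  apply: cycle_inB => //; last exact: (cycle_in_dd hTT).
  apply: cycle_inB => //.
  by case: (i) w' hw1 {hw2 cw ew u2 h2} => [//|i'] w' hw1 b; apply: mx_act_npow.
(* A sum written as a difference, so that [mx_actB] applies. *)
exists (fun a => w a - - w2 a) => a.
  have hS := npow_submodule n s hTT; apply: submoduleB => //; exact: submoduleN.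
have -> : u a - mx_act (D i) (fun a => w a - - w2 a) a = w' a + (u2 a - mx_act (D i) w2 a).
  have eN : mx_act (D i) (fun a => - w2 a) a = - mx_act (D i) w2 a.
    by rewrite /mx_act -sumrN; apply: eq_bigr => l _; rewrite scalerN.
  rewrite mx_actB eN opprK /u2 opprD !addrA; congr (_ - _ - _).
  by rewrite addrAC subrr add0r.
by apply: submoduleD => //; apply: npow_submodule.
Qed.

End Filtered.

Lemma tor_vanish_adic i j : (forall s (v : 'I_(crk C i) -> M),
    (forall a, npow n s.+1 setT (v a)) -> cycle_in (npow n s.+3 setT) v ->
    exists2 w, forall a, npow n s setT (w a) &
      forall a, npow n s.+2 setT (v a - mx_act (D i) w a)) ->
  j <> 0 + i%:Z -> tor_vanish C (gr_deg (adic n M)) i j.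
Proof.
move=> hex ji v hv cv; have [_ [lb _ _]] := hC 0.
have gM := @gr_graded_module R n M (adic n M).
(* j - i is the degree of the coefficients: 0 is the excluded case, s + 1 is covered by the
   hypothesis on approximate cycles, and negative degrees of gr vanish. *)
case E : (j - i%:Z) => [[|s]|s].
- by case: ji; rewrite add0r; apply/eqP; rewrite -subr_eq0 E.
- have /choice[x hx] a : exists x, npow n s.+1 setT x /\ v a = symbol (adic n M) s.+1 x.
    have := hv a; rewrite lb E => -[x hx ex].
    by exists x.
  have hx1 a := (hx a).1.
  have ev : v = fun a => symbol (adic n M) s.+1 (x a).
    by apply: funext => a; case: (hx a).
  rewrite ev in cv; have [w hw ew] := hex s x hx1 ((cycle_symbol (F := adic n M) (s :=
    s.+1) hx1).2 cv).
  exists (fun a => symbol (adic n M) s (w a)).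
    move=> a; rewrite lb; have -> : j - i.+1%:Z = s%:Z by lia.
    by exists (w a) => //; apply: hw.
  rewrite ev mx_act_symbol //; apply: funext => a; apply/symbol_eq.
  + exact: hx1.
  + exact: mx_act_npow.
  + exact: ew.
- exists (fun=> 0); first by move=> a; apply: (hom0 gM).
  apply: funext => a; rewrite mx_act0 //; apply: (hom_neg gM _ (hv a)).
  by rewrite lb E.
Qed.

End ModuleLifting.
End Lifting.

Theorem theorem3p6 (R : comNzRingType) (n : set R) (hR : regular_local n)
    (M : lmodType R) (hM0 : exists x : M, x <> 0) (hMfg : fin_gen [set: M])
    (F : filtration n M) (hF : stable F)
    (hmu : exists m : nat, is_mu [set: M] m /\ is_mu [set: gr F] m)
    (hcl : componentwise_linear (gr_ring_deg n) (gr_deg F)) :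
  koszul n M.
Proof.
have [hn hRn _] := hR; have hP := gr_ring_graded hn hRn.
have gM := @gr_graded_module R n M F.
have res t (i : nat) j : j <> t + i%:Z ->
    exists H : residue_resolution (gr_ring_deg n), tor_vanish (of_res H) (component
      (gr_deg F) t) i j.
  by move=> /hcl/betti0.
have [d [x [Fx nFx hgen]]] := exists_top_degree hn hM0 hMfg hF.
have Gx : gr_deg F d%:Z (symbol F d x) by exists x.
have x0 : symbol F d x <> 0 by move=> /symbol_eq0 h; apply: nFx; apply: h.
have [C hC] : exists C : cplx (gr_ring_deg n), forall N, exact_upto N C /\ linear_upto N C.
  apply: (linear_resolution_exists hP) => C i e z eC lC hz hzD.
  have {}hgen : gr_deg F (d%:Z + 1) `<=` smul setT (gr_deg F d%:Z).
    by have -> : d%:Z + 1 = d.+1%:Z by lia.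
  exact: (ker_generated hP gM Gx x0 hgen (res d%:Z) (res (d%:Z + 1)) eC lC hz hzD).
have [D hD] := lift_exists hn hC.
have eC N := (hC N).1.
split=> // i j ji; apply/betti0; exists (res_of eC).
suff : tor_vanish C (gr_deg (adic n M)) i j by [].
apply: (tor_vanish_adic hn hC hD) => // s v; apply: (adic_exact hn hRn hC hD (F := F)).
- move=> t i' j' /res[H hH].
  (* The witness [H] depends on all three indices; vanishing is moved to the one resolution whose
     differentials were lifted. *)
  apply: (tor_vanish_linear hP _ eC (fun N => (hC N).2) _ hH) => [|N].
    exact: component_family gM _.
  exact: of_res_exact.
- exact: (nM_filtration hn hRn hMfg hF hmu).
- exact: stable_sub.
Qed.
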